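(* For each $\varepsilon>0$ and $x^\varepsilon_0\in\mathbb{R}$, there exists a unique strong solution of the SDE $$dX^\varepsilon_t=\Big(b_t-\frac{c_tL_t}{\varepsilon}\,g\Big(\frac{M_tX^\varepsilon_t}{\varepsilon}\Big)\Big)dt+\sqrt{c_t}\,dW_t,\qquad X^\varepsilon_0=x^\varepsilon_0,\quad t\in[0,T].$$
   Context: $(\Omega,\mathcal{F},(\mathcal{F}_t)_{t\in[0,T]},\mathbb{P})$ is a filtered probability space satisfying the usual conditions, and $W$ is a standard Brownian motion on it. The processes $b,c,L,M$ on $[0,T]$ are adapted and continuous, and $c,L,M$ are positive. The function $g:\mathbb{R}\to\mathbb{R}$ is locally Lipschitz, odd, non-decreasing, nonnegative on $\mathbb{R}_+$, and satisfies $\liminf_{x\to\infty}g(x)/x^q>0$ for some $q\geq 1$. *)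

(* Defs.v *)
From HB Require Import structures.
From mathcomp Require Import all_boot all_order all_algebra.
From mathcomp Require Import all_classical all_reals all_analysis.

Set Implicit Arguments.
Unset Strict Implicit.
Unset Printing Implicit Defensive.
Import Order.TTheory GRing.Theory Num.Theory.
Import numFieldNormedType.Exports.

Local Open Scope classical_set_scope.
Local Open Scope ring_scope.

(* Filtrations and processes are indexed by all of [R] for convenience; only
   the indices in [`[0, T]] are ever constrained or used. *)
Section StochasticBasis.
Context {d : measure_display} {Omega : measurableType d} {R : realType}.
Implicit Types (P : probability Omega R) (T : R).
Implicit Types (F : R -> set (set Omega)) (X : R -> Omega -> R).

Record filtration F T : Prop := {
  filtration_sigma : forall t : R, 0 <= t <= T -> sigma_algebra setT (F t);
  filtration_sub : forall t : R, 0 <= t <= T -> F t `<=` measurable;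
  filtration_mono : forall s t : R, 0 <= s -> s <= t -> t <= T -> F s `<=` F t }.

Record usual_conditions P F T : Prop := {
  usual_complete : P.-negligible `<=` F 0;
  usual_right_continuous : forall t : R, 0 <= t < T ->
    \bigcap_(u in `]t, T]) F u `<=` F t }.

Definition measurable_wrt (G : set (set Omega)) (Z : Omega -> R) :=
  forall B : set R, measurable B -> G (Z @^-1` B).

Definition adapted F T X :=
  forall t : R, 0 <= t <= T -> measurable_wrt (F t) (X t).

Definition continuous_process T X :=
  forall w, {within `[0, T], continuous (fun t => X t w)}.

Definition indistinguishable P T X Y :=
  \forall w \ae P, forall t : R, 0 <= t <= T -> X t w = Y t w.

Definition increment X (s t : R) (w : Omega) : R := X t w - X s w.

Record brownian_motion P F T (W : R -> Omega -> R) : Prop := {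
  brownian_adapted : adapted F T W;
  brownian_continuous : continuous_process T W;
  brownian_start : \forall w \ae P, W 0 w = 0;
  brownian_indep : forall s t : R, 0 <= s -> s < t -> t <= T ->
    forall (A : set Omega) (B : set R), F s A -> measurable B ->
      P (A `&` increment W s t @^-1` B)
      = (P A * P (increment W s t @^-1` B))%E;
  brownian_gauss : forall s t : R, 0 <= s -> s < t -> t <= T ->
    forall B : set R, measurable B ->
      P (increment W s t @^-1` B) = normal_prob 0 (Num.sqrt (t - s)) B }.

(* The process [\sum_(i < n) xi_i 1_(t_i, t_(i+1)]] with
   [0 <= t_0 <= ... <= t_n <= T] and [xi_i] bounded and [F t_i]-measurable. *)
Record simple_process F T := SimpleProcess {
  sp_size : nat;
  sp_time : nat -> R;
  sp_coef : nat -> Omega -> R;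
  sp_time_ge0 : 0 <= sp_time 0%N;
  sp_time_le : forall i, (i < sp_size)%N -> sp_time i <= sp_time i.+1;
  sp_time_leT : sp_time sp_size <= T;
  sp_coef_bounded : forall i, (i < sp_size)%N ->
    exists K, forall w, `|sp_coef i w| <= K;
  sp_coef_measurable : forall i, (i < sp_size)%N ->
    measurable_wrt (F (sp_time i)) (sp_coef i) }.

Definition sp_val F T (H : simple_process F T) (s : R) (w : Omega) : R :=
  \sum_(i < sp_size H)
    sp_coef H i w * \1_`]sp_time H i, sp_time H i.+1] s.

Definition sp_integral F T (H : simple_process F T) (W : R -> Omega -> R)
    (t : R) (w : Omega) : R :=
  \sum_(i < sp_size H)
    sp_coef H i w * (W (Num.min (sp_time H i.+1) t) w
                     - W (Num.min (sp_time H i) t) w).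

Definition cvg_in_probability0 P (Z : nat -> Omega -> \bar R) :=
  forall e : R, 0 < e ->
    P [set w | (e%:E <= Z n w)%E] @[n --> \oo] --> (0 : \bar R).

(* [J] is (a version of) the process [t |-> \int_0^t H_s dW_s] on [`[0, T]]:
   the continuous adapted process which is the limit in probability of the
   elementary integrals of simple processes [Hn] such that
   [\int_0^T |Hn_s - H_s|^2 ds --> 0] in probability.  By the Ito isometry and
   localization, the limit does not depend on the approximating sequence, so
   that [J] is determined up to indistinguishability. *)
Definition is_ito_integral P F T (W H J : R -> Omega -> R) :=
  [/\ continuous_process T J, adapted F T J &
   exists Hn : nat -> simple_process F T,
     cvg_in_probability0 P (fun n w =>
       (\int[lebesgue_measure]_(s in `[0%R, T])
          ((sp_val (Hn n) s w - H s w) ^+ 2)%:E)%E) /\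
     forall t : R, 0 <= t <= T ->
       cvg_in_probability0 P (fun n w =>
         `|J t w - sp_integral (Hn n) W t w|%:E)].

(* [X] is a strong solution on [`[0, T]] of
     dX_t = beta_t(X_t) dt + sigma_t(X_t) dW_t,   X_0 = x0,
   on the given stochastic basis, where the coefficients may be random. *)
Definition strong_solution P F T (W : R -> Omega -> R)
    (beta sigma : R -> Omega -> R -> R) (x0 : R) X :=
  [/\ continuous_process T X,
      adapted F T X,
      \forall w \ae P,
        lebesgue_measure.-integrable `[0, T]
          (fun s : R => (beta s w (X s w))%:E) /\
        lebesgue_measure.-integrable `[0, T]
          (fun s : R => (sigma s w (X s w) ^+ 2)%:E),
      \forall w \ae P, X 0 w = x0 &
      exists2 J : R -> Omega -> R,
        is_ito_integral P F T W (fun s w => sigma s w (X s w)) J &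
        \forall w \ae P, forall t : R, 0 <= t <= T ->
          X t w = x0
            + \int[lebesgue_measure]_(s in `[0, t]) beta s w (X s w)
            + J t w].

Definition exists_unique_strong_solution P F T (W : R -> Omega -> R)
    (beta sigma : R -> Omega -> R -> R) (x0 : R) :=
  exists2 X, strong_solution P F T W beta sigma x0 X &
    forall Y, strong_solution P F T W beta sigma x0 Y ->
      indistinguishable P T X Y.

End StochasticBasis.

(* Main.v *)
Require Import Defs.
From HB Require Import structures.
From mathcomp Require Import all_boot all_order all_algebra.
From mathcomp Require Import all_classical all_reals all_analysis.
From mathcomp Require Import measurable_realfun ring lra.
Import Order.TTheory GRing.Theory Num.Theory.
Import numFieldNormedType.Exports.
Local Open Scope classical_set_scope.
Local Open Scope ring_scope.

(** The diffusion coefficient [sqrt c] does not involve the unknown process.  Its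
    stochastic integral [J] can therefore be constructed beforehand, and [X] solves
    the equation if and only if [V = X - x0 - J] solves, path by path, the ordinary
    differential equation [V' = b - a g(m (x0 + J + V))], [V 0 = 0], with
    [a = c L / eps >= 0] and [m = M / eps >= 0].

    The right-hand side of that equation is nonincreasing in [V], because [g] is
    nondecreasing, and this alone controls its solutions.  If [D = \int phi] and
    [2 D phi <= D^2 + psi], then [D^2 <= e^t \int psi] ([primitive_energy]).  Applied
    to the difference of two solutions, this gives pathwise uniqueness
    ([drift_unique]); applied to one solution, an a priori bound which excludes
    explosion ([monotone_ode]); applied to two approximations
    [V(t) = \int_0^t f(s, V(s - d)) ds] with small delays [d], the convergence of this
    scheme ([delayed_cvg]).  The scheme is explicit, and so its limit is adapted
    ([random_monotone_ode]).

    The construction of [J] and its uniqueness both rest on a maximal inequality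
    ([sp_integral_close]): if two simple processes are at squared distance at most
    [eta] from the same integrand, with high probability, then their integrals differ
    by at least [delta] at some time of a finite set with probability of order
    [eta / delta^2].  On a grid that is common to both processes, the difference is a
    sum of products of a coefficient and a Gaussian increment independent of the past.
    By the symmetry of the normal law, every such product adds to the second moment at
    most a multiple of the squared coefficient ([independent_normal_quadratic]), and
    stopping the sum when its energy exceeds [eta] or its modulus reaches [delta] turns
    the resulting second moment bound into the maximal inequality
    ([step_integral_maximal]).

    Two processes [J] obtained from two approximating sequences then agree at every
    fixed time, hence, by continuity, at all times ([ito_unique]).  For the existence
    ([ito_exists]), the Riemann approximations of [sqrt c] are taken along a
    subsequence so fast that, by the Borel-Cantelli lemma, their integrals converge
    uniformly on the time interval off a null set; this set belongs to the initial
    sigma-algebra by completeness, so that the limit is adapted. *)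

Set Implicit Arguments.
Unset Strict Implicit.
Unset Printing Implicit Defensive.

(** * The projection of the line onto a time interval *)

Section Clamp.
Context {R : realType}.

(** Composing a path with this projection replaces continuity relative to the interval by
    continuity on the whole line. *)
Definition clamp (T t : R) : R := Num.max 0 (Num.min t T).

Lemma clamp_id (T t : R) : 0 <= t <= T -> clamp T t = t.
Proof. by move=> /andP[t0 tT]; rewrite /clamp (min_idPl tT) (max_idPr t0). Qed.

Lemma clamp_itv (T : R) (T0 : 0 <= T) (t : R) : 0 <= clamp T t <= T.
Proof. by rewrite /clamp le_max lexx/= ge_max T0 ge_min lexx orbT. Qed.

Lemma clamp_lip (T s t : R) : `|clamp T t - clamp T s| <= `|t - s|.
Proof.
rewrite /clamp /Num.max /Num.min.
by case: (ltP t T) => ?; case: (ltP s T) => ?; case: (ltP 0 t) => ?; case: (ltP 0 s) => ?;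
  case: (ltP 0 T) => ?; rewrite ler_norml;
 have := ler_norm (t - s); have := ler_norm (s - t); rewrite (distrC s) => ? ?; apply/andP;
   split; lra.
Qed.

Lemma clamp_continuous (T : R) : 0 <= T -> continuous (clamp T).
Proof.
move=> T0 t; apply: (@continuous_max R R (cst 0) (fun t => Num.min t T) t);
  first exact: cvg_cst.
by apply: (@continuous_min R R id (cst T) t); [exact: cvg_id|exact: cvg_cst].
Qed.

Lemma clamp_continuous_within (T : R) (f : R -> R) : 0 <= T ->
  {within `[0, T], continuous f} -> continuous (fun t => f (clamp T t)).
Proof.
move=> T0 /subspace_continuousP cf t.
have ct s : `[0, T]%classic (clamp T s) by rewrite /= in_itv/= clamp_itv.
apply: (@cvg_comp _ _ _ (clamp T) f _ _ _ _ (cf _ (ct t))) => U.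
move=> wU; have : nbhs t (clamp T @^-1` (fun x => `[0, T]%classic x -> U x)).
  exact: (@clamp_continuous T T0 t _ wU).
by apply: filterS => s /=; apply; exact: (ct s).
Qed.

Lemma within_continuous_clamp (T : R) (f : R -> R) :
  continuous (fun t => f (clamp T t)) -> {within `[0, T], continuous f}.
Proof.
move=> cf; have cf' : {within `[0, T], continuous (fun t => f (clamp T t))}.
  exact: continuous_subspaceT.
apply: subspace_eq_continuous cf' => t; rewrite inE/= in_itv/= => tT.
by congr (f _); rewrite clamp_id.
Qed.

End Clamp.

(** * Primitives of continuous functions *)

Section PathIntegral.
Context {R : realType}.
Implicit Types (phi psi : R -> R).
Notation mu := (@lebesgue_measure R).

Definition primitive phi (t : R) : R := \int[mu]_(s in `[0, t]) phi s.

Lemma continuous_integrable phi (a b : R) :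
  continuous phi -> mu.-integrable `[a, b] (EFin \o phi).
Proof.
move=> cphi; apply: continuous_compact_integrable; first exact: segment_compact.
exact: continuous_subspaceT.
Qed.

Lemma primitive_le0 phi (t : R) : t <= 0 -> primitive phi t = 0.
Proof.
rewrite /primitive le_eqVlt => /predU1P[->|t0]; first by rewrite set_itv1 Rintegral_set1.
by rewrite set_itv_ge ?Rintegral_set0// bnd_simp -ltNge.
Qed.

Lemma primitive_cst (K t : R) : 0 <= t -> primitive (cst K) t = K * t.
Proof.
move=> t0; rewrite /primitive Rintegral_cst//= lebesgue_measure_itv/= lte_fin.
case: ltP => //= h; first by rewrite subr0.
by have -> : t = 0 by lra.
Qed.

Lemma primitiveB phi (s t : R) : continuous phi -> 0 <= s -> s <= t ->
  primitive phi t - primitive phi s = \int[mu]_(u in `]s, t]) phi u.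
Proof.
move=> cphi s0 st; rewrite /primitive Rintegral_itvB ?bnd_simp//.
exact: continuous_integrable.
Qed.

(** The bound is required at nonnegative points only, so that the lemma applies across
    the origin, where delayed arguments start. *)
Lemma primitive_lip phi (C s t : R) : continuous phi -> s <= t -> 0 <= C ->
  (forall u : R, 0 <= u -> s <= u <= t -> `|phi u| <= C) ->
  `|primitive phi t - primitive phi s| <= C * (t - s).
Proof.
move=> cphi; wlog s0 : s / 0 <= s => [H st C0 phiC|].
  have [s0|/ltW s0] := leP 0 s; first exact: H.
  have [t0|/ltW t0] := leP t 0.
    by rewrite !primitive_le0// subrr normr0 mulr_ge0// subr_ge0.
  rewrite (primitive_le0 _ s0) -(primitive_le0 phi (lexx 0)).
  rewrite (le_trans (H 0 (lexx _) t0 C0 _))//; last by apply: ler_wpM2l => //; lra.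
  by move=> u u0 /andP[_ ut]; apply: phiC; rewrite // ut (le_trans s0).
move=> st C0 phiC; rewrite primitiveB//.
have iphi : mu.-integrable `]s, t] (EFin \o phi).
  by apply: integrableS (continuous_integrable s t cphi) => //; exact: subset_itv_oc_cc.
apply: (le_trans (le_normr_Rintegral _ iphi)) => //.
rewrite (@le_trans _ _ (\int[mu]_(u in `]s, t]) C))//; last first.
  by rewrite Rintegral_cst//= lebesgue_measure_itv/=; case: ifPn => //=;
    rewrite lte_fin => st' ; rewrite mulr0 mulr_ge0// subr_ge0.
apply: le_Rintegral => //.
- exact: integrable_norm.
- by apply: integrableS (continuous_integrable s t (@cst_continuous _ _ C)) => //;
  exact: subset_itv_oc_cc.
- move=> u /=; rewrite in_itv/= => /andP[su ut]; apply: phiC.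
    by rewrite (le_trans s0)// ltW.
  by rewrite ut ltW.
Qed.

Lemma primitive_continuous phi : continuous phi -> continuous (primitive phi).
Proof.
move=> cphi t.
have : compact `[t - 1, t + 1] by exact: segment_compact.
move=> /(continuous_compact (continuous_subspaceT cphi)) /compact_bounded[M [_ MP]].
pose C := `|M| + 1.
have C0 : 0 < C by rewrite /C ltr_wpDl.
have phiC u : t - 1 <= u <= t + 1 -> `|phi u| <= C.
  move=> tu; apply: (MP C); last by exists u; rewrite //= in_itv.
  by rewrite /C (le_lt_trans (ler_norm M))// ltrDl.
have lip s : `|t - s| <= 1 -> `|primitive phi t - primitive phi s| <= C * `|t - s|.
  move=> ts; have [st|/ltW st] := leP s t.
    rewrite (ger0_norm (_ : 0 <= t - s)) ?subr_ge0//; apply: primitive_lip => //;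
      first exact: ltW.
    by move=> u _ /andP[su ut]; apply: phiC; move: ts; rewrite ler_norml => /andP[]; lra.
  rewrite distrC (distrC t); rewrite (ger0_norm (_ : 0 <= s - t)) ?subr_ge0//;
    apply: primitive_lip => //; first exact: ltW.
  by move=> u _ /andP[su ut]; apply: phiC; move: ts; rewrite ler_norml => /andP[]; lra.
apply/cvgrPdist_lt => e e0; near=> s.
apply: (@le_lt_trans _ _ (C * `|t - s|)); first apply: lip.
  by near: s; apply/nbhs_ballP; exists 1 => //= s /ltW.
rewrite mulrC -ltr_pdivlMr//; near: s; apply/nbhs_ballP; exists (e / C) => //=.
by rewrite divr_gt0.
Unshelve. all: by end_near. Qed.

Lemma primitive_derive phi (t : R) : continuous phi -> 0 < t ->
  is_derive t 1 (primitive phi) (phi t).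
Proof.
move=> cphi t0.
have [|dF <-] := @continuous_FTC1_closed R phi 0 t (t + 1) _ (continuous_integrable 0 (t +
  1) cphi) t0 (cphi t).
  by rewrite ltrDl.
by rewrite derive1E; split.
Qed.

Lemma eq_primitive phi psi (t : R) : (forall s : R, 0 <= s <= t -> phi s = psi s) ->
  primitive phi t = primitive psi t.
Proof.
by move=> e; apply: eq_Rintegral => s; rewrite inE/= in_itv/=; exact: e.
Qed.

(** Gronwall's argument: the derivative of [e^-t D^2 - \int psi], for [D] the primitive of
    [phi], is [e^-t (2 D phi - D^2) - psi <= (e^-t - 1) psi <= 0]. *)
Lemma primitive_energy phi psi (T t : R) : continuous phi -> continuous psi ->
  (forall s : R, 0 <= s <= T -> 0 <= psi s) ->
  (forall s : R, 0 <= s <= T ->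
     2 * (primitive phi s * phi s) <= primitive phi s ^+ 2 + psi s) ->
  0 <= t <= T -> primitive phi t ^+ 2 <= expR t * primitive psi t.
Proof.
move=> cphi cpsi psi0 H /andP[t0 tT].
pose D := primitive phi.
pose G s := expR (- s) * D s ^+ 2 - primitive psi s.
have dG (s : R) : 0 < s -> is_derive s 1 G
    (expR (- s) * (2 * (D s * phi s)) + D s ^+ 2 * - expR (- s) - psi s).
  move=> s0.
  have d1 := primitive_derive cphi s0.
  have d2 := primitive_derive cpsi s0.
  have d3 : is_derive s 1 (fun s => expR (- s)) (- expR (-s)).
    by apply: is_derive_eq; rewrite /GRing.scale/= ?(mulrN, mulNr, mul1r, mulr1).
  apply: is_derive_eq; rewrite /GRing.scale /= /D; ring.
have : G t <= G 0.
  apply: (@ler0_derive1_nincr _ G 0 t) => //.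
  - by move=> s /[!in_itv]/= /andP[s0 st]; have [] := dG _ s0.
  - move=> s /[!in_itv]/= /andP[s0 st].
    have sT : 0 <= s <= T by rewrite ltW//= ltW// (lt_le_trans st).
    rewrite derive1E; have [_ ->] := dG _ s0.
    have e1 : expR (- s) <= 1 by rewrite -expR0 ler_expR oppr_le0 ltW.
    have : expR (- s) * (2 * (D s * phi s) - D s ^+ 2) <= psi s.
      apply: (@le_trans _ _ (expR (- s) * psi s)).
        by rewrite ler_wpM2l ?expR_ge0// lerBlDl H.
      by rewrite ler_piMl// psi0.
    lra.
  - apply: continuous_subspaceT => s; apply: cvgB; last exact: primitive_continuous.
    apply: cvgM; first by apply: continuous_comp; [exact: opp_continuous|exact:
      continuous_expR].
    by apply: cvgM; exact: primitive_continuous.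
rewrite /G /D !(primitive_le0 _ (lexx 0)) expr0n mulr0 subrr subr_le0 => h.
have := ler_wpM2l (expR_ge0 t) h.
by rewrite mulrA -expRD subrr expR0 mul1r.
Qed.

End PathIntegral.

(** * Bounded nonincreasing differential equations *)

(** Keeping the rate in the limit is what later makes pointwise limits of paths uniform. *)
Lemma cvg_cauchy_rate {R : realType} (u r : nat -> R) :
  (forall n m, (n <= m)%N -> `|u n - u m| <= r n) -> r @ \oo --> (0 : R) ->
  exists l, u @ \oo --> l /\ forall n, `|u n - l| <= r n.
Proof.
move=> ur r0.
have cu : cvg (u @ \oo).
  apply: cauchy_cvg; apply: cauchy_exP => e e0.
  have /cvgrPdist_lt/(_ _ e0)[N _ rN] := r0.
  exists (u N); exists N => // m /= Nm; rewrite /ball/=.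
  apply: (le_lt_trans (ur _ _ Nm)).
  by have := rN N (leqnn _); rewrite sub0r normrN; apply: le_lt_trans; exact: ler_norm.
exists (lim (u @ \oo)); split=> // n; apply/ler_addgt0Pr => e e0.
have /cvgrPdist_le/(_ _ e0)[N _ uN] := cu.
have := uN (maxn N n) (leq_maxl _ _).
have := ur n (maxn N n) (leq_maxr _ _).
set v := u (maxn N n); rewrite distrC (distrC _ v) => h1 h2.
rewrite (le_trans (ler_distD v _ _))// lerD// distrC//.
Qed.

Section DelayedScheme.
Context {R : realType}.
Implicit Types (f : R -> R -> R).
Notation mu := (@lebesgue_measure R).

(** Iterates of [x |-> \int_0^t f(s, x(s - d)) ds].  A primitive vanishes at negative
    times, which provides the initial segment of the delayed equation. *)
Fixpoint delayed f (d : R) (k : nat) : R -> R :=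
  if k is k'.+1 then primitive (fun s => f s (delayed f d k' (s - d))) else cst 0.

Lemma primitive_cvg (phi : nat -> R -> R) (phi' : R -> R) (C t : R) :
  (forall n, continuous (phi n)) -> continuous phi' ->
  (forall n (s : R), `|phi n s| <= C) ->
  (forall s : R, 0 <= s <= t -> phi n s @[n --> \oo] --> phi' s) ->
  primitive (phi n) t @[n --> \oo] --> primitive phi' t.
Proof.
move=> cphi cphi' phiC phi_cvg.
have [_ _ H] : [/\ mu.-integrable `[0, t] (EFin \o phi'),
  (fun n => \int[mu]_(x in `[0%R, t]) (`|(phi n x)%:E - (phi' x)%:E|)%E)%E @ \oo --> 0%E &
  (fun n => \int[mu]_(x in `[0%R, t]) (phi n x)%:E)%E @ \oo --> (\int[mu]_(x in `[0%R, t])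
    (phi' x)%:E)%E].
  apply: (@dominated_convergence _ _ _ mu `[0, t]%classic _ (fun n x =>
    (phi n x)%:E) _ (cst C%:E)) => //.
  - by move=> n; apply/measurable_EFinP/measurable_funTS; exact: continuous_measurable_fun.
  - by apply/measurable_EFinP/measurable_funTS; exact: continuous_measurable_fun.
  - apply/aeW => s; rewrite /= in_itv/= => st; apply: cvg_EFin; first exact: nearW.
    exact: phi_cvg.
  - exact: (continuous_integrable 0 t (@cst_continuous _ _ C)).
  - by apply/aeW => s n _ /=; rewrite lee_fin.
rewrite /primitive /Rintegral; apply: fine_cvg; rewrite fineK//.
have /integrable_fin_num := continuous_integrable 0 t cphi'; exact.
Qed.

Lemma continuous_along (f' : R -> R -> R) (u : R -> R) :
  continuous (fun p : R * R => f' p.1 p.2) ->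
  continuous u -> continuous (fun s : R => f' s (u s)).
Proof.
move=> cf cu s.
apply: (@continuous_comp R (R * R)%type R (fun s => (s, u s)) (fun p : R * R => f' p.1 p.2));
  last exact: cf.
by apply: (@cvg_pair _ _ _ _ (nbhs s) (nbhs (u s))); [exact: cvg_id|exact: cu].
Qed.

Lemma continuous_shift_fun (u : R -> R) (d : R) : continuous u ->
  continuous (fun s : R => u (s - d)).
Proof.
move=> cu s; apply: (@continuous_comp _ _ _ (fun s => s - d) u); last exact: cu.
by apply: cvgB; [exact: cvg_id|exact: cvg_cst].
Qed.

Section Bounded.
Variables (f : R -> R -> R) (C T : R).
Hypothesis f_continuous : continuous (fun p : R * R => f p.1 p.2).
Hypothesis f_noninc : forall t x y, x <= y -> f t y <= f t x.
Hypothesis f_bounded : forall t x, `|f t x| <= C.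
Hypothesis T0 : 0 <= T.

Let C0 : 0 <= C.
Proof. exact: le_trans (normr_ge0 _) (f_bounded 0 0). Qed.

Lemma delayed_continuous d k : continuous (delayed f d k).
Proof.
elim: k => [|k IH] /=; first exact: cst_continuous.
by apply: primitive_continuous; apply: continuous_along => //; exact: continuous_shift_fun.
Qed.

Let step_continuous d k : continuous (fun s => f s (delayed f d k (s - d))).
Proof.
by apply: continuous_along => //; apply: continuous_shift_fun; exact: delayed_continuous.
Qed.

Lemma delayed_lip d k (s t : R) : s <= t ->
  `|delayed f d k t - delayed f d k s| <= C * (t - s).
Proof.
move=> st; case: k => [|k] /=; first by rewrite subrr normr0 mulr_ge0// subr_ge0.
by apply: primitive_lip.
Qed.

(** The value of an iterate at [t] depends on the previous one up to [t - d] only; every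
    iteration thus settles one more interval of length [d]. *)
Lemma delayed_stable d k t : 0 < d -> t <= k%:R * d ->
  delayed f d k.+1 t = delayed f d k t.
Proof.
move=> d0; elim: k t => [|k IH] t tk.
  by rewrite /= primitive_le0//; rewrite mul0r in tk.
rewrite [LHS]/= [RHS]/=; apply: eq_primitive => s /andP[s0 st]; congr (f s _).
by apply: IH; rewrite mulrS mulrDl mul1r in tk; lra.
Qed.

(** The number of iterations suffices to settle the time interval. *)
Let V d := delayed f d (Num.truncn (T / d)).+1.

Let V_eq d t : 0 < d -> t <= T -> V d t = primitive (fun s => f s (V d (s - d))) t.
Proof.
move=> d0 tT; rewrite {1}/V [LHS]/=; apply: eq_primitive => s /andP[s0 st]; congr (f s _).
rewrite /V delayed_stable//.
have : T / d < (Num.truncn (T / d)).+1%:R by exact: truncnS_gt.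
rewrite ltr_pdivrMr// -natr1 mulrDl mul1r; lra.
Qed.

Let A := 4 * C ^+ 2 * T * expR T.

(** Let [D] be the difference of the two solutions and [phi] that of their derivatives.
    Up to the displacements [C d] and [C e] due to the delays, [D] is the difference of
    the arguments at which [f] is evaluated in [phi]; as [f] is nonincreasing, [D phi] is
    then at most [(C d + C e) * 2 C]. *)
Let V_cauchy d e t : 0 < d -> 0 < e -> 0 <= t <= T ->
  (V d t - V e t) ^+ 2 <= A * (d + e).
Proof.
move=> d0 e0 /andP[t0 tT].
pose phi s := f s (V d (s - d)) - f s (V e (s - e)).
have cV x : continuous (V x) by exact: delayed_continuous.
have cphix x : continuous (fun s => f s (V x (s - x))) by exact: step_continuous.
have cphi : continuous phi by move=> s; apply: cvgB; exact: cphix.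
have VE s : s <= T -> primitive phi s = V d s - V e s.
  move=> sT; rewrite !V_eq//.
  by rewrite /primitive RintegralB//; exact: continuous_integrable.
rewrite -VE//.
pose K := 4 * C ^+ 2 * (d + e).
have K0 : 0 <= K by rewrite mulr_ge0 ?mulr_ge0 ?sqr_ge0// addr_ge0// ltW.
have : primitive phi t ^+ 2 <= expR t * (K * t).
  rewrite -(primitive_cst K t0).
  apply: (@primitive_energy _ phi (cst K) T) => //; [exact: cst_continuous| |by rewrite t0].
  move=> s /andP[s0 sT]; rewrite VE//.
  have hd : `|V d s - V d (s - d)| <= C * d.
    have := @delayed_lip d (Num.truncn (T / d)).+1 (s - d) s.
    by rewrite opprB addrCA subrr addr0; apply; rewrite gerBl ltW.
  have he : `|V e s - V e (s - e)| <= C * e.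
    have := @delayed_lip e (Num.truncn (T / e)).+1 (s - e) s.
    by rewrite opprB addrCA subrr addr0; apply; rewrite gerBl ltW.
  have m : (V d (s - d) - V e (s - e)) * phi s <= 0.
    rewrite /phi; have [h|/ltW h] := leP (V d (s - d)) (V e (s - e)).
      by rewrite mulr_le0_ge0// ?subr_le0// ?subr_ge0 f_noninc.
    by rewrite mulr_ge0_le0// ?subr_ge0// ?subr_le0 f_noninc.
  have hphi : `|phi s| <= 2 * C.
    by rewrite (le_trans (ler_normB _ _))// mulrDl mul1r lerD.
  have : (V d s - V d (s - d) - (V e s - V e (s - e))) * phi s <= (C * d + C * e) * (2 * C).
    rewrite (le_trans (ler_norm _))// normrM ler_pM//.
    by rewrite (le_trans (ler_normB _ _))// lerD.
  have := sqr_ge0 (V d s - V e s); rewrite /K/=.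
  move: m; set a := V d s; set b := V e s; set p := phi s; set a' := V d _; set b' := V e _.
  move=> h1 h2 h3.
  (* the first summand has the right sign, the second is due to the delays *)
  have -> : (a - b) * p = (a' - b') * p + (a - a' - (b - b')) * p by ring.
  have : 4 * C ^+ 2 * (d + e) = 2 * ((C * d + C * e) * (2 * C)) by ring.
  lra.
move=> h; apply: (le_trans h).
have -> : A * (d + e) = expR T * (K * T) by rewrite /A /K; ring.
apply: ler_pM; [exact: expR_ge0|exact: mulr_ge0|by rewrite ler_expR|exact: ler_wpM2l].
Qed.

(** The approximations are [C]-Lipschitz, and so is their limit; the delayed arguments
    therefore converge as well, and the limit satisfies the equation without delay. *)
Lemma delayed_cvg : exists2 X : R -> R, continuous X &
  forall t : R, 0 <= t <= T ->
    delayed f n.+1%:R^-1 (Num.truncn (T / n.+1%:R^-1)).+1 t @[n --> \oo] --> X t /\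
      X t = primitive (fun s => f s (X s)) t.
Proof.
pose r n : R := n.+1%:R^-1.
have r0 n : 0 < r n by rewrite invr_gt0.
have rmono n m : (n <= m)%N -> r m <= r n.
  by move=> nm; rewrite lef_pV2 ?posrE// ler_nat.
have A0 : 0 <= A by rewrite !mulr_ge0// ?sqr_ge0// expR_ge0.
pose q n := Num.sqrt (A * 2) * Num.sqrt (r n).
have q0 : q n @[n --> \oo] --> (0 : R).
  rewrite -(mulr0 (Num.sqrt (A * 2))); apply: cvgM; first exact: cvg_cst.
  rewrite -[X in _ --> X]sqrtr0; apply: continuous_cvg; first exact: sqrt_continuous.
  exact: cvg_harmonic.
have Vq t n m : 0 <= t <= T -> (n <= m)%N -> `|V (r n) t - V (r m) t| <= q n.
  move=> tT nm; rewrite -sqrtr_sqr /q -sqrtrM ?mulr_ge0//.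
  apply: ler_wsqrtr; apply: (le_trans (V_cauchy (r0 n) (r0 m) tT)).
  have -> : A * 2 * r n = A * (r n + r n) by ring.
  by apply: ler_wpM2l => //; rewrite lerD2l rmono.
have /choice[X0 HX] : forall t, exists l, 0 <= t <= T ->
    V (r n) t @[n --> \oo] --> l /\ forall n, `|V (r n) t - l| <= q n.
  move=> t; have [tT|] := boolP (0 <= t <= T); last by exists 0.
  have [l Hl] := @cvg_cauchy_rate _ (fun n => V (r n) t) q (fun n m => Vq t n m tT) q0.
  by exists l.
pose X (t : R) : R := X0 (clamp T t).
have Xlip s t : `|X t - X s| <= C * `|t - s|.
  have [Ht _] := HX _ (clamp_itv T0 t); have [Hs _] := HX _ (clamp_itv T0 s).
  apply: (ler_cvg_to (cvg_norm (cvgB Ht Hs)) (cvg_cst (C * `|t - s|))).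
  apply: nearW => n /=.
  apply: (@le_trans _ _ (C * `|clamp T t - clamp T s|)); last by rewrite ler_wpM2l// clamp_lip.
  have [st|/ltW st] := leP (clamp T s) (clamp T t).
    by rewrite (ger0_norm (_ : 0 <= clamp T t - _)) ?subr_ge0//; exact: delayed_lip.
  rewrite distrC (distrC (clamp T t)) (ger0_norm (_ : 0 <= clamp T s - _)) ?subr_ge0//.
  exact: delayed_lip.
have Xcont : continuous X.
  have C1 : 0 < C + 1 by rewrite ltr_wpDl.
  move=> t; apply/cvgrPdist_lt => e e0; near=> s.
  apply: (le_lt_trans (Xlip s t)).
  apply: (@le_lt_trans _ _ ((C + 1) * `|t - s|)); first by rewrite ler_wpM2r// lerDl.
  rewrite mulrC -ltr_pdivlMr//; near: s; apply/nbhs_ballP; exists (e / (C + 1)) => //=.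
  by rewrite divr_gt0.
have VX t : 0 <= t <= T -> V (r n) t @[n --> \oo] --> X t.
  by move=> tT; rewrite /X clamp_id//; have [] := HX t tT.
exists X => // t tT; split; first exact: VX.
have E n : V (r n) t = primitive (fun s => f s (V (r n) (s - r n))) t.
  by rewrite V_eq//; case/andP: tT.
have lim1 : V (r n) t @[n --> \oo] --> primitive (fun s => f s (X s)) t.
  rewrite (funext E); apply: (@primitive_cvg _ _ C) => //.
  - by move=> n; exact: step_continuous.
  - exact: continuous_along.
  - move=> s /andP[s0 st].
    have sT : 0 <= s <= T by rewrite s0 (le_trans st)//; case/andP: tT.
    have sh : V (r n) (s - r n) @[n --> \oo] --> X s.
      have -> : (fun n => V (r n) (s - r n)) = (fun n =>
        V (r n) s - (V (r n) s - V (r n) (s - r n))).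
        by apply/funext => n; rewrite opprB addrCA subrr addr0.
      rewrite -[X in _ --> X]subr0; apply: cvgB; first exact: VX.
      apply/norm_cvg0P; apply: (@squeeze_cvgr _ _ _ _ (cst 0) (fun n => C * r n)).
      + apply: nearW => n; rewrite normr_ge0/=.
        have := @delayed_lip (r n) (Num.truncn (T / r n)).+1 (s - r n) s.
        by rewrite opprB addrCA subrr addr0; apply; rewrite gerBl ltW.
      + exact: cvg_cst.
      + by rewrite -(mulr0 C); apply: cvgM; [exact: cvg_cst|exact: cvg_harmonic].
    by apply: (@continuous2_cvg nat R R R \oo _ (cst s) _ f s (X s));
      [exact: (@f_continuous (s, X s))|exact: cvg_cst|exact: sh].
exact: (cvg_unique _ (VX t tT) lim1).
Unshelve. all: by end_near. Qed.

End Bounded.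
End DelayedScheme.

(** * Unbounded nonincreasing differential equations *)

Section MonotoneODE.
Context {R : realType}.
Implicit Types (f : R -> R -> R).

Definition clip (b x : R) : R := Num.max (- b) (Num.min x b).

(** If [x' = f(t, x)] with [x 0 = 0] and [f] nonincreasing in [x], then
    [2 x x' <= 2 x f(t, 0) <= x^2 + f(t, 0)^2], hence
    [x^2 <= e^t \int f(s, 0)^2 ds].  The summand 1 turns this into a bound of [|x|] without
    a square root.  This bound at time [t] depends on the past of [f] only, so that
    truncating at it preserves adaptedness. *)
Definition envelope f (t : R) : R := 1 + expR t * primitive (fun s => f s 0 ^+ 2) t.

Definition truncated f (T t x : R) : R :=
  f (clamp T t) (clip (envelope f (clamp T t)) x).

Lemma clip_continuous : continuous (fun p : R * R => clip p.1 p.2).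
Proof.
move=> p; apply: (@continuous_max R (R * R)%type (fun p => - p.1) (fun p => Num.min p.2 p.1) p).
  by apply: continuousN; exact: cvg_fst.
by apply: (@continuous_min R (R * R)%type snd fst p); [exact: cvg_snd|exact: cvg_fst].
Qed.

Lemma clip_id (b x : R) : `|x| <= b -> clip b x = x.
Proof. by rewrite ler_norml => /andP[bx xb]; rewrite /clip (min_idPl xb) (max_idPr bx). Qed.

Lemma clip_itv (b x : R) : 0 <= b -> - b <= clip b x <= b.
Proof. by move=> b0; rewrite /clip le_max lexx/= ge_max ge_min lexx orbT andbT; lra. Qed.

Lemma clip_le (b x y : R) : x <= y -> clip b x <= clip b y.
Proof.
by move=> xy; rewrite /clip ge_max le_max lexx/= le_max le_min !ge_min xy lexx !orbT.
Qed.

Lemma continuous2_cst f (x : R) : continuous (fun p : R * R => f p.1 p.2) ->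
  continuous (f^~ x).
Proof. by move=> cf; apply: continuous_along => //; exact: cst_continuous. Qed.

Lemma envelope_continuous f : continuous (fun p : R * R => f p.1 p.2) ->
  continuous (envelope f).
Proof.
move=> cf t; apply: cvgD; first exact: cvg_cst.
apply: cvgM; first exact: continuous_expR.
apply: primitive_continuous => s.
by apply: cvgM; exact: (@continuous2_cst f 0 cf).
Qed.

Lemma envelope_ge1 f (t : R) : 1 <= envelope f t.
Proof.
rewrite lerDl mulr_ge0 ?expR_ge0//; apply: Rintegral_ge0 => s _; exact: sqr_ge0.
Qed.

Section Existence.
Variables (f : R -> R -> R) (T : R).
Hypothesis f_continuous : continuous (fun p : R * R => f p.1 p.2).
Hypothesis f_noninc : forall t x y, x <= y -> f t y <= f t x.
Hypothesis T0 : 0 <= T.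

Let B := envelope f.
Let B1 t : 1 <= B t. Proof. exact: envelope_ge1. Qed.
Let B0 t : 0 <= B t. Proof. exact: le_trans (B1 t). Qed.
Let cB : continuous B. Proof. exact: envelope_continuous. Qed.

Lemma truncated_continuous : continuous (fun p : R * R => truncated f T p.1 p.2).
Proof.
move=> p; rewrite /truncated.
apply: (@continuous2_cvg _ R R R (nbhs p) _ (fun p => clamp T p.1)
  (fun p => clip (B (clamp T p.1)) p.2) f); first exact: (@f_continuous (_, _)).
  by apply: (@continuous_comp _ _ _ fst (clamp T)); [exact: cvg_fst|exact: clamp_continuous].
apply: (@continuous2_cvg _ R R R (nbhs p) _ (fun p => B (clamp T p.1)) snd clip).
- exact: (@clip_continuous (_, _)).
- apply: (@continuous_comp _ _ _ fst (B \o clamp T)); first exact: cvg_fst.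
  by apply: continuous_comp; [exact: clamp_continuous|exact: cB].
- exact: cvg_snd.
Qed.

Lemma truncated_noninc (t x y : R) : x <= y -> truncated f T t y <= truncated f T t x.
Proof. by move=> xy; apply: f_noninc; exact: clip_le. Qed.

(** The arguments of [f] in [truncated] range over a compact rectangle. *)
Lemma truncated_bounded : exists C, forall t x, `|truncated f T t x| <= C.
Proof.
have /compact_bounded[M [_ MP]] : compact (B @` `[0, T]%classic).
  by apply: continuous_compact; [exact: continuous_subspaceT|exact: segment_compact].
pose N := `|M| + 1.
have BN t : B (clamp T t) <= N.
  apply: le_trans (ler_norm _) _; apply: MP;
    first by rewrite /N (le_lt_trans (ler_norm M))// ltrDl.
  by exists (clamp T t) => //=; rewrite in_itv/= clamp_itv.
have /compact_bounded[C [_ CP]] :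
    compact ((fun p : R * R => f p.1 p.2) @` (`[0, T]%classic `*` `[-N, N]%classic)).
  apply: continuous_compact; first exact: continuous_subspaceT.
  by apply: compact_setX; exact: segment_compact.
exists (`|C| + 1) => t x; apply: CP; first by rewrite (le_lt_trans (ler_norm C))// ltrDl.
exists (clamp T t, clip (B (clamp T t)) x) => //=; split; rewrite /= in_itv/= ?clamp_itv//.
have /andP[h1 h2] := clip_itv x (B0 (clamp T t)).
have := BN t; rewrite -/B; set b := B _ in h1 h2 *; move=> bN; lra.
Qed.

(** The solution of the truncated equation is confined to the region where the truncation
    is inactive, by the estimate that defines [envelope]. *)
Lemma monotone_ode : exists2 X : R -> R, continuous X &
  forall t : R, 0 <= t <= T ->
    delayed (truncated f T) n.+1%:R^-1 (Num.truncn (T / n.+1%:R^-1)).+1 t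
      @[n --> \oo] --> X t /\
    X t = primitive (fun s => f s (X s)) t.
Proof.
have [C hC] := truncated_bounded.
have [X cX HX] := delayed_cvg truncated_continuous truncated_noninc hC T0.
exists X => // t tT; split; first by have [] := HX t tT.
have XE s : 0 <= s <= T -> X s = primitive (fun u => truncated f T u (X u)) s.
  by move=> sT; have [] := HX s sT.
have cphi : continuous (fun u => truncated f T u (X u)).
  by apply: continuous_along => //; exact: truncated_continuous.
have cf0 : continuous (fun s => f s 0 ^+ 2).
  by move=> s; apply: cvgM; exact: (@continuous2_cst f 0 f_continuous).
have bound s : 0 <= s <= T -> `|X s| <= B s.
  move=> sT; have : primitive (fun u => truncated f T u (X u)) s ^+ 2 <=
    expR s * primitive (fun u => f u 0 ^+ 2) s.
    apply: (@primitive_energy _ _ _ T) => //; first by move=> u _; exact: sqr_ge0.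
    move=> u uT; rewrite -XE//.
    (* 0 is never clipped *)
    have h0 : truncated f T u 0 = f u 0.
      by rewrite /truncated clip_id ?normr0// clamp_id.
    have : X u * (truncated f T u (X u) - truncated f T u 0) <= 0.
      have [h|/ltW h] := leP 0 (X u).
        by rewrite mulr_ge0_le0// subr_le0 truncated_noninc.
      by rewrite mulr_le0_ge0// subr_ge0 truncated_noninc.
    rewrite h0; have := sqr_ge0 (X u - f u 0); nra.
  rewrite -XE// -[leRHS in _ <= leRHS](addKr 1) addrC -/(envelope f s) -/B => h.
  have b1 := B1 s.
  rewrite -(@ler_pXn2r _ 2) ?nnegrE// real_normK ?num_real//.
  by apply: (le_trans h); nra.
rewrite [LHS]XE//; apply: eq_primitive => s /andP[s0 st].
have sT : 0 <= s <= T by rewrite s0 (le_trans st)//; case/andP: tT.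
by rewrite /truncated clamp_id// clip_id// bound.
Qed.

End Existence.
End MonotoneODE.

(** * Measurability of integrals depending on a parameter *)

Section Caratheodory.
Context {R : realType} {d : measure_display} {Omega : measurableType d}.
Implicit Types (h : R -> Omega -> R).
Notation mu := (@lebesgue_measure R).

(** [h s w] is the limit of [h (floor (s n) / n) w], in which the first argument takes
    countably many values. *)
Lemma measurable_caratheodory h : (forall w, continuous (h^~ w)) ->
  (forall s, measurable_fun setT (h s)) ->
  measurable_fun setT (fun p : R * Omega => h p.1 p.2).
Proof.
move=> ch mh.
pose grid n (s : R) : R := (Num.floor (s * n.+1%:R))%:~R / n.+1%:R.
apply: (@measurable_fun_cvg _ _ _ _ (fun n p => h (grid n p.1) p.2)) => /=.
- move=> n _ B mB; rewrite setTI.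
  rewrite (_ : _ @^-1` _ = \bigcup_(k : int)
    ([set s : R | Num.floor (s * n.+1%:R) = k] `*` (h (k%:~R / n.+1%:R) @^-1` B))).
    apply: countable_bigcupT_measurable => // k; apply: measurableX.
      rewrite (_ : [set _ | _] = `[k%:~R / n.+1%:R, (k + 1)%:~R / n.+1%:R[%classic)//.
      apply/seteqP; split=> s /=; rewrite in_itv/= ler_pdivrMr// ltr_pdivlMr//.
        by move=> <-; exact: floor_itv.
      exact: floor_def.
    by rewrite -[X in measurable X]setTI; exact: mh.
  apply/seteqP; split=> [[s w]/= sB|[s w] [k _] /= [<-]//].
  by exists (Num.floor (s * n.+1%:R)).
- move=> [s w] _ /=.
  have gs : grid n s @[n --> \oo] --> s.
    apply/cvgrPdist_le => e e0.
    have /cvgrPdist_le/(_ _ e0)[N _ HN] := @cvg_harmonic R.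
    exists N => // n /HN /=; rewrite sub0r normrN ger0_norm ?invr_ge0// => hn.
    apply: (le_trans _ hn).
    have n0 : 0 < n.+1%:R :> R by [].
    have -> : s - grid n s = (s * n.+1%:R - (Num.floor (s * n.+1%:R))%:~R) / n.+1%:R.
      by rewrite mulrBl mulfK// gt_eqF.
    have /andP[h1 h2] := floor_itv (s * n.+1%:R).
    rewrite ger0_norm; last by rewrite divr_ge0// subr_ge0.
    rewrite ler_pdivrMr// mulVf ?gt_eqF//.
    by rewrite intrD in h2; lra.
  exact: (@cvg_comp _ _ _ (grid^~ s) (h^~ w) _ (nbhs s) _ gs (@ch w s)).
Qed.

Lemma measurable_integral (k : R * Omega -> R) (D : set R) : measurable D ->
  measurable_fun setT k -> (forall p, 0 <= k p) ->
  measurable_fun setT (fun w => \int[mu]_(s in D) (k (s, w))%:E)%E.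
Proof.
move=> mD mk k0.
pose f (p : R * Omega) : \bar R := (k p * \1_D p.1)%:E.
have mf : measurable_fun setT f.
  apply/measurable_EFinP; apply: measurable_funM => //.
  by apply: measurableT_comp => //; exact: measurable_indic.
have f0 p : (0 <= f p)%E by rewrite lee_fin mulr_ge0.
have := @measurable_fun_fubini_tonelli_G _ _ _ _ _ mu f mf f0.
rewrite /fubini_G; congr measurable_fun; apply/funext => w.
rewrite [RHS]integral_mkcond; apply: eq_integral => s _.
by rewrite /f patchE indicE; case: (s \in D); rewrite ?mulr1 ?mulr0.
Qed.

Lemma measurable_primitive h (t : R) : (forall w, continuous (h^~ w)) ->
  (forall s, measurable_fun setT (h s)) ->
  measurable_fun setT (fun w => primitive (h^~ w) t).
Proof.
move=> ch mh; have mH := measurable_caratheodory ch mh.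
have E w : primitive (h^~ w) t =
    fine (\int[mu]_(s in `[0%R, t]) (Num.max (h s w) 0)%:E)%E -
    fine (\int[mu]_(s in `[0%R, t]) (Num.max (- h s w) 0)%:E)%E.
  rewrite /primitive /Rintegral integralE fineB.
  - by congr (fine _ - fine _); apply: eq_integral => s _;
    rewrite ?funeposE ?funenegE/= -?EFinN EFin_max.
  - by apply: integrable_pos_fin_num => //; exact: continuous_integrable.
  - by apply: integrable_neg_fin_num => //; exact: continuous_integrable.
rewrite (funext E); apply: measurable_funB.
- apply: measurableT_comp; first exact: fine_measurable.
  apply: (@measurable_integral (fun p => Num.max (h p.1 p.2) 0)) => //.
    by apply: measurable_maxr.
  by move=> p; rewrite le_max lexx orbT.
- apply: measurableT_comp; first exact: fine_measurable.
  apply: (@measurable_integral (fun p => Num.max (- h p.1 p.2) 0)) => //.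
    by apply: measurable_maxr => //; exact: measurableT_comp.
  by move=> p; rewrite le_max lexx orbT.
Qed.

End Caratheodory.

(** * Adapted solutions of random differential equations *)

Section MeasurableWrt.
Context {R : realType} {d : measure_display} {Omega : measurableType d}.
Implicit Types (G : set (set Omega)) (Z : Omega -> R).

(** A sub-sigma-algebra is turned into a measurable type, over which the closure
    properties of measurable functions are available. *)
Lemma measurable_wrtP G Z : sigma_algebra setT G ->
  measurable_wrt G Z <->
  measurable_fun (setT : set (g_sigma_algebraType G)) (Z : g_sigma_algebraType G -> R).
Proof.
move=> sG; split=> [mZ _ B mB|mZ B mB].
  by rewrite setTI; apply: sub_sigma_algebra; exact: mZ.
have := mZ measurableT B mB.
by rewrite setTI /measurable/= (sigma_algebra_id sG).
Qed.

Lemma measurable_wrt_primitive G (h : R -> Omega -> R) (t : R) : sigma_algebra setT G ->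
  (forall w, continuous (h^~ w)) ->
  (forall s : R, 0 <= s <= t -> measurable_wrt G (h s)) ->
  measurable_wrt G (fun w => primitive (h^~ w) t).
Proof.
move=> sG ch mh; have [t0|/ltW t0] := leP 0 t; last first.
  have -> : (fun w => primitive (h^~ w) t) = cst 0 by apply/funext => w; rewrite primitive_le0.
  by apply/(measurable_wrtP _ sG).
have -> : (fun w => primitive (h^~ w) t) = (fun w => primitive (fun s => h (clamp t s) w) t).
  by apply/funext => w; apply: eq_primitive => s st; rewrite clamp_id.
apply/(measurable_wrtP _ sG).
apply: (@measurable_primitive _ _ (g_sigma_algebraType G) (fun s => h (clamp t s))).
  by move=> w s; apply: (@continuous_comp _ _ _ (clamp t) (h^~ w));
    [exact: clamp_continuous|exact: ch].
by move=> s; apply/measurable_wrtP => //; apply: mh; exact: clamp_itv.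
Qed.

End MeasurableWrt.

Section RandomODE.
Context {R : realType} {d : measure_display} {Omega : measurableType d}.
Variables (F : R -> set (set Omega)) (T : R).
Hypotheses (F_filtration : filtration F T) (T0 : 0 <= T).

(** Substituting a random variable known at time [t] for the unknown gives a random variable
    known at time [t]; this is what an explicit scheme asks of its right-hand side. *)
Definition superposable (f : R -> Omega -> R -> R) :=
  forall t Z, 0 <= t <= T -> measurable_wrt (F t) Z ->
    measurable_wrt (F t) (fun w => f t w (Z w)).

Let sF t (tT : 0 <= t <= T) : sigma_algebra setT (F t) := filtration_sigma F_filtration tT.

Lemma adapted_delayed (f : R -> Omega -> R -> R) (delta : R) k :
  (forall w, continuous (fun p : R * R => f p.1 w p.2)) -> superposable f -> 0 <= delta ->
  forall s t : R, s <= t -> 0 <= t <= T ->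
    measurable_wrt (F t) (fun w => delayed (fun s x => f s w x) delta k s).
Proof.
move=> cf mf d0; elim: k => [|k IH] s t st tT /=.
  by apply/(measurable_wrtP _ (sF tT)).
have cphi w : continuous (fun u : R => f u w (delayed (fun s x =>
  f s w x) delta k (u - delta))).
  apply: (@continuous_along _ (fun s x => f s w x)) => //.
  by apply: continuous_shift_fun; exact: delayed_continuous.
apply: (@measurable_wrt_primitive _ _ _ _ (fun u w => f u w (delayed (fun s x =>
  f s w x) delta k (u - delta)))) => //.
  exact: sF.
move=> u /andP[u0 us].
have uT : 0 <= u <= T by rewrite u0/= (le_trans us)// (le_trans st)//; case/andP: tT.
have ut : u <= t by exact: le_trans st.
move=> B mB; apply: (filtration_mono F_filtration u0 ut); first by case/andP: tT.
apply: (mf u _ uT) => //; apply: IH => //; by rewrite gerBl.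
Qed.

Lemma superposable_truncated (f : R -> Omega -> R -> R) :
  (forall w, continuous (fun p : R * R => f p.1 w p.2)) -> superposable f ->
  superposable (fun t w x => truncated (fun s x => f s w x) T t x).
Proof.
move=> cf mf t Z tT mZ.
rewrite /truncated (clamp_id tT).
apply: (mf t) => //; apply/(measurable_wrtP _ (sF tT)).
have mB : measurable_wrt (F t) (fun w => envelope (fun s x => f s w x) t).
  apply/(measurable_wrtP _ (sF tT)); apply: measurable_funD => //; apply: measurable_funM => //.
  apply/(measurable_wrtP _ (sF tT)).
  apply: (@measurable_wrt_primitive _ _ _ _ (fun s w => f s w 0 ^+ 2)); first exact: sF.
    by move=> w s; apply: cvgM; exact: (@continuous2_cst _ (fun s x => f s w x) 0 (cf w)).
  move=> s /andP[s0 st].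
  have sT : 0 <= s <= T by rewrite s0 (le_trans st)//; case/andP: tT.
  apply/(measurable_wrtP _ (sF tT)); apply: measurable_funX.
  apply/(measurable_wrtP _ (sF tT)) => B mB; apply: (filtration_mono F_filtration s0 st).
    by case/andP: tT.
  by apply: (mf s (cst 0)) => //; apply/(measurable_wrtP _ (sF sT)).
move/(measurable_wrtP _ (sF tT)) : mB => mB; move/(measurable_wrtP _ (sF tT)) : mZ => mZ.
by apply: measurable_maxr; [exact: measurableT_comp|exact: measurable_minr].
Qed.

(** The solution is chosen path by path, but it is the limit of the explicit scheme and
    inherits its measurability. *)
Lemma random_monotone_ode (f : R -> Omega -> R -> R) :
  (forall w, continuous (fun p : R * R => f p.1 w p.2)) ->
  (forall t w x y, x <= y -> f t w y <= f t w x) -> superposable f ->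
  exists X : R -> Omega -> R, [/\ forall w, continuous (X^~ w), adapted F T X &
    forall w (t : R), 0 <= t <= T -> X t w = primitive (fun s => f s w (X s w)) t].
Proof.
move=> cf nf mf.
have /choice[X HX] : forall w, exists X : R -> R, continuous X /\
  forall t : R, 0 <= t <= T ->
    delayed (truncated (fun s x => f s w x) T) n.+1%:R^-1 (Num.truncn (T / n.+1%:R^-1)).+1 t
      @[n --> \oo] --> X t /\
    X t = primitive (fun s => f s w (X s)) t.
  by move=> w; have [X ? ?] := monotone_ode (cf w) (fun t => nf t w) T0; exists X.
exists (fun t w => X w t); split.
- by move=> w; have [] := HX w.
- move=> t tT; apply/(measurable_wrtP _ (sF tT)).
  apply: (@measurable_fun_cvg _ (g_sigma_algebraType (F t)) R setT (fun n w =>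
    delayed (truncated (fun s x => f s w x) T) n.+1%:R^-1 (Num.truncn (T / n.+1%:R^-1)).+1 t)).
    move=> n; apply/(measurable_wrtP _ (sF tT)).
    apply: (@adapted_delayed (fun t w x => truncated (fun s x => f s w x) T t x)) => //.
    + by move=> w; exact: truncated_continuous.
    + exact: superposable_truncated.
  by move=> w _; have [_ /(_ _ tT)[]] := HX w.
- by move=> w t tT; have [_ /(_ _ tT)[]] := HX w.
Qed.

End RandomODE.

(** * A second moment bound for the normal distribution *)

Section NormalMoments.
Context {R : realType}.
Notation mu := (@lebesgue_measure R).

(** The density agrees almost everywhere with the Radon-Nikodym derivative, for which the
    change of variables is known. *)
Lemma ge0_integral_normal_prob (m sigma : R) (f : R -> \bar R) :
  measurable_fun setT f -> (forall x, 0 <= f x)%E ->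
  (\int[normal_prob m sigma]_x f x = \int[mu]_x (f x * (normal_pdf m sigma x)%:E))%E.
Proof.
move=> mf f0; have dom := @normal_prob_dominates R m sigma.
have iRN := Radon_Nikodym_SigmaFinite.f_integrable dom.
have mpdf : measurable_fun setT (fun x => (normal_pdf m sigma x)%:E).
  by apply/measurable_EFinP; exact: measurable_normal_pdf.
rewrite -(Radon_Nikodym_SigmaFinite.change_of_variables dom)//.
apply: ae_eq_integral => //.
- by apply: emeasurable_funM => //; exact: measurable_int iRN.
- exact: emeasurable_funM.
apply: ae_eqe_mul2l; apply: integral_ae_eq => // A _ mA.
by rewrite -(Radon_Nikodym_SigmaFinite.f_integral dom).
Qed.

(** Both sides are the sum of the integrals of [f x] and [f (- x)] over the half-line. *)
Lemma ge0_integral_opp (f : R -> R) : continuous f -> (forall x, 0 <= f x) ->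
  (\int[mu]_x (f x)%:E = \int[mu]_x (f (- x))%:E)%E.
Proof.
have fold (h : R -> R) : continuous h -> (forall x, 0 <= h x) ->
    (\int[mu]_x (h x)%:E =
     \int[mu]_(x in `[0%R, +oo[) (h x)%:E + \int[mu]_(x in `[0%R, +oo[) (h (- x))%:E)%E.
  move=> ch h0.
  have mh : measurable_fun [set: R] h by exact: continuous_measurable_fun.
  rewrite -(setUv `[0%R, +oo[%classic) ge0_integral_setU//=; last 4 first.
  - exact: measurableC.
  - by apply/measurable_EFinP; rewrite setUv.
  - by move=> x _; rewrite lee_fin.
  - exact/disj_setPCl.
  congr (_ + _)%E; rewrite setCitvr.
  rewrite integral_itv_bndo_bndc; last exact/measurable_EFinP/measurable_funTS.
  rewrite -{1}oppr0 ge0_integration_by_substitutionNy//.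
  exact: continuous_subspaceT.
move=> cf f0; rewrite fold// [RHS]fold//.
  by rewrite addeC; congr (_ + _)%E; apply: eq_integral => x _; rewrite opprK.
move=> x; apply: (@continuous_comp _ _ _ -%R f); last exact: cf.
exact: opp_continuous.
Qed.

(** Doubling the standard deviation absorbs the quadratic factor.  With
    [u = x^2 / (8 sigma^2)], the exponentials are [e^(-4 u)] and [e^-u], and [u <= e^(3 u)];
    the other factor 2 of the constant is the ratio of the peaks. *)
Lemma sqr_normal_pdf_le (sigma x : R) : 0 < sigma ->
  x ^+ 2 * normal_pdf 0 sigma x <= 16 * sigma ^+ 2 * normal_pdf 0 (2 * sigma) x.
Proof.
move=> s0; rewrite !normal_pdfE ?gt_eqF ?mulr_gt0//.
have -> : normal_peak sigma = 2 * normal_peak (2 * sigma).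
  rewrite /normal_peak; have -> : ((2 * sigma) ^+ 2 * pi *+ 2) =
    2 ^+ 2 * (sigma ^+ 2 * pi *+ 2) :> R.
    by rewrite !mulr2n; ring.
  by rewrite sqrtrM ?sqr_ge0// sqrtr_sqr ger0_norm// invfM mulrA divff// mul1r.
have p0 : 0 <= normal_peak (2 * sigma) by exact: normal_peak_ge0.
rewrite /normal_fun !subr0 (_ : (2 * sigma) ^+ 2 = 4 * sigma ^+ 2); last by ring.
have : 0 < sigma ^+ 2 by rewrite exprn_gt0.
move: (sigma ^+ 2) => w s2; have w0 : w != 0 by rewrite gt_eqF.
pose u := x ^+ 2 / (8 * w).
have u0 : 0 <= u by rewrite divr_ge0 ?sqr_ge0// mulr_ge0// ltW.
have -> : - x ^+ 2 / (w *+ 2) = - u - 3 * u.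
  by rewrite /u -[in LHS](mulr_natl _ 2); field.
have -> : - x ^+ 2 / (4 * w *+ 2) = - u.
  by rewrite /u -[in LHS](mulr_natl _ 2); field.
have -> : x ^+ 2 = 8 * w * u by rewrite /u; field.
rewrite expRD; set E := expR (- u).
have ue : u * expR (- (3 * u)) <= 1.
  rewrite expRN ler_pdivrMr ?expR_gt0// mul1r.
  by apply: le_trans (expR_ge1Dx _); lra.
have E0 : 0 <= E by exact: expR_ge0.
have -> : 8 * w * u * (2 * normal_peak (2 * sigma) * (E * expR (- (3 * u)))) =
  16 * w * (normal_peak (2 * sigma) * E) * (u * expR (- (3 * u))) by ring.
rewrite [leRHS](_ : _ = 16 * w * (normal_peak (2 * sigma) * E) * 1); last by rewrite mulr1.
by rewrite ler_wpM2l// !mulr_ge0// ltW.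
Qed.

(** Averaging the integral with its image under [x |-> - x] cancels the cross term. *)
Lemma normal_quadratic (sigma a k : R) : 0 < sigma ->
  (\int[normal_prob 0 sigma]_x ((a + k * x) ^+ 2)%:E <=
   (a ^+ 2 + 16 * sigma ^+ 2 * k ^+ 2)%:E)%E.
Proof.
move=> s0.
have cq (k' : R) : continuous (fun x : R => (a + k' * x) ^+ 2).
  by move=> x; apply: cvgM; apply: cvgD; try exact: cvg_cst; apply: cvgM;
    (exact: cvg_cst || exact: cvg_id).
have mq k' : measurable_fun setT (fun x : R => (a + k' * x) ^+ 2) by apply:
  continuous_measurable_fun.
have mp s : measurable_fun setT (normal_pdf (0 : R) s) by exact: measurable_normal_pdf.
rewrite ge0_integral_normal_prob; last 2 first.
- by apply/measurable_EFinP.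
- by move=> x; rewrite lee_fin sqr_ge0.
under eq_integral do rewrite -EFinM.
set I := (\int[mu]_x _)%E.
have IE : I = (\int[mu]_x (((a + - k * x) ^+ 2 * normal_pdf 0 sigma x)%:E))%E.
  rewrite /I (@ge0_integral_opp (fun x => (a + k * x) ^+ 2 * normal_pdf 0 sigma x)).
  - apply: eq_integral => x _; congr EFin; congr (_ * _); first by rewrite mulrN mulNr.
    by rewrite !normal_pdfE ?gt_eqF// /normal_fun !subr0 sqrrN.
  - move=> x; apply: cvgM; first exact: cq.
    by apply: continuous_normal_pdf; rewrite gt_eqF.
  - by move=> x; rewrite mulr_ge0 ?sqr_ge0 ?normal_pdf_ge0.
pose c := a ^+ 2 + 16 * sigma ^+ 2 * k ^+ 2.
have II : (I + I <= (2 * c)%:E)%E.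
  rewrite {1}IE -ge0_integralD//=; last 4 first.
  - by move=> x _; rewrite lee_fin mulr_ge0 ?sqr_ge0 ?normal_pdf_ge0.
  - by apply/measurable_EFinP; apply: measurable_funM; [exact: mq|exact: mp].
  - by move=> x _; rewrite lee_fin mulr_ge0 ?sqr_ge0 ?normal_pdf_ge0.
  - by apply/measurable_EFinP; apply: measurable_funM; [exact: mq|exact: mp].
  pose u (x : R) := 2 * a ^+ 2 * normal_pdf 0 sigma x.
  pose v (x : R) := 2 * (16 * sigma ^+ 2 * k ^+ 2) * normal_pdf 0 (2 * sigma) x.
  have uv : (\int[mu]_x ((u x)%:E + (v x)%:E) = (2 * c)%:E)%E.
    have u0 x : 0 <= u x by rewrite /u mulr_ge0 ?normal_pdf_ge0// mulr_ge0// sqr_ge0.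
    have v0 x : 0 <= v x.
      by rewrite /v mulr_ge0 ?normal_pdf_ge0// mulr_ge0// mulr_ge0 ?sqr_ge0// mulr_ge0//
        sqr_ge0.
    have mu' : measurable_fun setT u by apply: measurable_funM;
      [exact: measurable_cst|exact: mp].
    have mv : measurable_fun setT v by apply: measurable_funM;
      [exact: measurable_cst|exact: mp].
    rewrite ge0_integralD//=; last 4 first.
      by move=> x _; rewrite lee_fin.
      by apply/measurable_EFinP.
      by move=> x _; rewrite lee_fin.
      by apply/measurable_EFinP.
    rewrite /u /v; under eq_integral do rewrite EFinM.
    under [X in (_ + X)%E]eq_integral do rewrite EFinM.
    rewrite !ge0_integralZl//=; try by [apply/measurable_EFinP; exact: mp |
      move=> x _; rewrite lee_fin normal_pdf_ge0 |
      rewrite lee_fin mulr_ge0// sqr_ge0 | rewrite lee_fin mulr_ge0// mulr_ge0 ?sqr_ge0//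
        mulr_ge0// sqr_ge0].
    by rewrite !integral_normal_pdf !mule1 -EFinD /c; congr EFin; ring.
  rewrite -uv; apply: ge0_le_integral => //=.
  - by move=> x _; rewrite -EFinD lee_fin addr_ge0// mulr_ge0 ?sqr_ge0 ?normal_pdf_ge0.
  - by apply: emeasurable_funD; apply/measurable_EFinP; apply: measurable_funM;
    by [exact: mq|exact: mp|exact: measurable_cst].
  - by apply: emeasurable_funD; apply/measurable_EFinP; apply: measurable_funM;
    by [exact: mq|exact: mp|exact: measurable_cst].
  - move=> x _; rewrite -!EFinD lee_fin /u /v.
    have := sqr_normal_pdf_le x s0.
    move=> /(ler_wpM2l (sqr_ge0 k)) h.
    have -> : (a + - k * x) ^+ 2 * normal_pdf 0 sigma x + (a +
      k * x) ^+ 2 * normal_pdf 0 sigma x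
       = 2 * a ^+ 2 * normal_pdf 0 sigma x +
         2 * (k ^+ 2 * (x ^+ 2 * normal_pdf 0 sigma x)) by ring.
    rewrite lerD2l; have -> : 2 * (16 * sigma ^+ 2 * k ^+ 2) * normal_pdf 0 (2 * sigma) x =
      2 * (k ^+ 2 * (16 * sigma ^+ 2 * normal_pdf 0 (2 * sigma) x)) by ring.
    by rewrite ler_wpM2l.
move: II; rewrite -/c; clear IE; move: I => [r| |] //=.
by rewrite -EFinD !lee_fin; lra.
by rewrite !leNye.
Qed.

End NormalMoments.

(** * Increments independent of the past *)

Section IndependentNormal.
Context {R : realType} {d : measure_display} {Omega : measurableType d}.
Variable P : probability Omega R.
Implicit Types (G : set (set Omega)) (S xi D : Omega -> R).

Lemma measurable_wrt_measurable G (Z : Omega -> R) : G `<=` measurable ->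
  measurable_wrt G Z -> measurable_fun setT Z.
Proof. by move=> GM mZ _ B mB; rewrite setTI; apply: GM; exact: mZ. Qed.

(** The map [w |-> (w, D w)], with values in the product of [Omega] equipped with [G] and of
    the line, has law [P] times the normal law; by Tonelli's theorem [S w] and [xi w] are
    constants in the inner integral. *)
Lemma independent_normal_quadratic G S xi D (sigma : R) :
  sigma_algebra setT G -> G `<=` measurable -> 0 < sigma ->
  measurable_fun setT D -> measurable_wrt G S -> measurable_wrt G xi ->
  (forall (A : set Omega) (B : set R), G A -> measurable B ->
    P (A `&` D @^-1` B) = (P A * normal_prob 0 sigma B)%E) ->
  (\int[P]_w ((S w + xi w * D w) ^+ 2)%:E <=
   \int[P]_w (S w ^+ 2 + 16 * sigma ^+ 2 * xi w ^+ 2)%:E)%E.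
Proof.
move=> sG GM s0 mD mS mxi indep.
pose O' := g_sigma_algebraType G.
pose RR := measurableTypeR R.
have mid : measurable_fun (setT : set Omega) (id : Omega -> O').
  by move=> _ A; rewrite setTI /measurable/= (sigma_algebra_id sG); exact: GM.
pose idX : {mfun Omega >-> O'} := HB.pack (id : Omega ->
  O') (isMeasurableFun.Build _ _ _ _ _ mid).
have mpair : measurable_fun (setT : set Omega) (fun w => ((w : O'), (D w : RR))).
  exact: measurable_fun_pair.
pose pairX : {mfun Omega >-> (O' * RR)%type} :=
  HB.pack (fun w => ((w : O'), (D w : RR))) (isMeasurableFun.Build _ _ _ _ _ mpair).
pose m1 := distribution P idX.
pose N := @normal_prob R 0 sigma.
have mS' : measurable_fun setT (S : O' -> R) by exact/measurable_wrtP.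
have mxi' : measurable_fun setT (xi : O' -> R) by exact/measurable_wrtP.
pose h (z : O' * RR) : \bar R := ((S z.1 + xi z.1 * z.2) ^+ 2)%:E.
have mh : measurable_fun setT h.
  apply/measurable_EFinP; apply: measurable_funX; apply: measurable_funD.
    exact: measurableT_comp.
  by apply: measurable_funM => //; exact: measurableT_comp.
have h0 z : (0 <= h z)%E by rewrite lee_fin sqr_ge0.
rewrite (_ : (\int[P]_w _)%E = (\int[distribution P pairX]_z h z)%E); last first.
  by rewrite ge0_integral_distribution.
rewrite (_ : (\int[P]_w (S w ^+ 2 + _)%:E)%E =
    (\int[m1]_w (S w ^+ 2 + 16 * sigma ^+ 2 * xi w ^+ 2)%:E)%E); last first.
  rewrite ge0_integral_distribution//.
    apply/measurable_EFinP; apply: measurable_funD; first exact: measurable_funX.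
    by apply: measurable_funM => //; exact: measurable_funX.
  by move=> w; rewrite lee_fin addr_ge0 ?sqr_ge0// mulr_ge0 ?sqr_ge0// mulr_ge0 ?sqr_ge0.
have -> : (\int[distribution P pairX]_z h z = \int[m1 \x N]_z h z)%E.
  apply: (@eq_measure_integral _ (O' * RR)%type R setT (m1 \x N)%E (distribution P pairX) h)
    => A mA _; apply/esym.
  apply: product_measure_unique => //= A1 B1 mA1 mB1.
  (* on rectangles this is the independence of [G] and [D] *)
  rewrite /m1 /distribution /pushforward/= -indep//.
  by move: mA1; rewrite /measurable/= (sigma_algebra_id sG).
rewrite fubini_tonelli1//; apply: ge0_le_integral => //.
- by move=> w _; apply: integral_ge0.
- exact: measurable_fun_fubini_tonelli_F.
- apply/measurable_EFinP; apply: measurable_funD; first exact: measurable_funX.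
  by apply: measurable_funM => //; exact: measurable_funX.
- by move=> w _; exact: (normal_quadratic (S w) (xi w) s0).
Qed.

End IndependentNormal.

(** * Martingale sums along a grid *)

Section DiscreteIntegral.
Context {R : realType} {d : measure_display} {Omega : measurableType d}.
Variables (P : probability Omega R) (T : R) (F : R -> set (set Omega)).
Variable W : R -> Omega -> R.
Hypotheses (F_filtration : filtration F T) (W_brownian : brownian_motion P F T W).
Variable tau : nat -> R.
Hypothesis tau_itv : forall i, 0 <= tau i <= T.
Hypothesis tau_le : forall i, tau i <= tau i.+1.

Let tau_mono i j : (i <= j)%N -> tau i <= tau j.
Proof. by move=> ij; apply: (@homo_leq _ tau (fun x y => x <= y)) => //; exact: le_trans. Qed.

Let sF i : sigma_algebra setT (F (tau i)) := filtration_sigma F_filtration (tau_itv i).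
Let FM i : F (tau i) `<=` measurable := filtration_sub F_filtration (tau_itv i).

Lemma measurable_wrt_le (s t : R) (Z : Omega -> R) : 0 <= s -> s <= t -> t <= T ->
  measurable_wrt (F s) Z -> measurable_wrt (F t) Z.
Proof.
by move=> s0 st tT mZ B mB; apply: (filtration_mono F_filtration s0 st tT); exact: mZ.
Qed.

Let mle i j (Z : Omega -> R) : (i <= j)%N -> measurable_wrt (F (tau i)) Z ->
  measurable_wrt (F (tau j)) Z.
Proof.
move=> ij; apply: measurable_wrt_le; last by case/andP: (tau_itv j).
- by case/andP: (tau_itv i).
- exact: tau_mono.
Qed.

Implicit Type K : nat -> Omega -> R.

Definition step_integral K n (w : Omega) : R :=
  \sum_(i < n) K i w * increment W (tau i) (tau i.+1) w.

Definition step_energy K n (w : Omega) : R := \sum_(i < n) K i w ^+ 2 * (tau i.+1 - tau i).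

Definition predictable K := forall i, measurable_wrt (F (tau i)) (K i).

Lemma step_integral_measurable K n : predictable K ->
  measurable_wrt (F (tau n)) (step_integral K n).
Proof.
move=> mK; apply/(measurable_wrtP _ (sF n)).
apply: (@measurable_sum _ (g_sigma_algebraType (F (tau n))) R setT) => i.
apply: measurable_funM; first by apply/(measurable_wrtP _ (sF n));
  exact: (mle (ltnW (ltn_ord i)) (mK i)).
have mW j : measurable_wrt (F (tau j)) (W (tau j)) := brownian_adapted W_brownian (tau_itv j).
apply: measurable_funB.
  by apply/(measurable_wrtP _ (sF n)); exact: (@mle i.+1 _ _ (ltn_ord i) (mW _)).
by apply/(measurable_wrtP _ (sF n)); exact: (@mle i _ _ (ltnW (ltn_ord i)) (mW _)).
Qed.

Lemma step_energy_measurable K n : predictable K ->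
  measurable_wrt (F (tau n.-1)) (step_energy K n).
Proof.
move=> mK; apply/(measurable_wrtP _ (sF _)).
apply: (@measurable_sum _ (g_sigma_algebraType (F (tau n.-1))) R setT) => i.
apply: measurable_funM => //; apply: measurable_funX.
apply/(measurable_wrtP _ (sF n.-1)); apply: (mle _ (mK i)).
by case: n i => [[]//|k [i] /=].
Qed.

Let dtau0 i : 0 <= tau i.+1 - tau i. Proof. by rewrite subr_ge0. Qed.

(** The Ito isometry, as an inequality: one increment at a time, the second moment grows
    by the energy of the new coefficient. *)
Lemma step_integral_sqr_le K n : predictable K ->
  (\int[P]_w (step_integral K n w ^+ 2)%:E <= \int[P]_w (16 * step_energy K n w)%:E)%E.
Proof.
move=> mK; elim: n => [|n IH].
  by rewrite /step_integral /step_energy; under eq_integral do rewrite big_ord0 expr0n/=;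
    under [leRHS]eq_integral do rewrite big_ord0 mulr0.
have mdint := measurable_wrt_measurable (@FM n) (step_integral_measurable n mK).
have mKn := measurable_wrt_measurable (@FM n) (mK n).
have mE k : measurable_fun setT (step_energy K k) :=
  measurable_wrt_measurable (@FM k.-1) (step_energy_measurable k mK).
have E0 k w : 0 <= step_energy K k w by apply: sumr_ge0 => i _; rewrite mulr_ge0 ?sqr_ge0.
apply: (@le_trans _ _ (\int[P]_w (step_integral K n w ^+ 2 +
  16 * (tau n.+1 - tau n) * K n w ^+ 2)%:E)%E).
  under eq_integral do rewrite /step_integral big_ord_recr/=.
  have := tau_le n; rewrite le_eqVlt => /predU1P[e|lt].
    rewrite le_eqVlt; apply/orP; left; apply/eqP; apply: eq_integral => w _.
    by rewrite /increment -e !subrr !mulr0 mul0r !addr0.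
  have s0 : 0 < Num.sqrt (tau n.+1 - tau n) by rewrite sqrtr_gt0 subr_gt0.
  have /andP[t0 _] := tau_itv n; have /andP[_ tT] := tau_itv n.+1.
  have := @independent_normal_quadratic _ _ _ P (F (tau n)) (step_integral K n) (K n)
    (increment W (tau n) (tau n.+1)) _ (sF n) (@FM n) s0 _ (step_integral_measurable n mK)
      (mK n).
  rewrite sqr_sqrtr//; apply.
    apply: measurable_funB.
      by apply: (measurable_wrt_measurable (@FM n.+1)); exact: (brownian_adapted W_brownian).
    by apply: (measurable_wrt_measurable (@FM n)); exact: (brownian_adapted W_brownian).
  move=> A B FA mB; rewrite (brownian_indep W_brownian)//.
  by rewrite (brownian_gauss W_brownian).
under eq_integral do rewrite EFinD.
rewrite ge0_integralD//=; last 4 first.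
- by move=> w _; rewrite lee_fin sqr_ge0.
- by apply/measurable_EFinP; exact: measurable_funX.
- by move=> w _; rewrite lee_fin mulr_ge0 ?sqr_ge0// mulr_ge0.
- by apply/measurable_EFinP; apply: measurable_funM => //; exact: measurable_funX.
apply: (@le_trans _ _ (\int[P]_w (16 * step_energy K n w)%:E +
  \int[P]_w (16 * (tau n.+1 - tau n) * K n w ^+ 2)%:E)%E).
  exact: leeD2r.
rewrite -ge0_integralD//=; last 4 first.
- by move=> w _; rewrite lee_fin mulr_ge0.
- by apply/measurable_EFinP; exact: measurable_funM.
- by move=> w _; rewrite lee_fin mulr_ge0 ?sqr_ge0// mulr_ge0.
- by apply/measurable_EFinP; apply: measurable_funM => //; exact: measurable_funX.
rewrite le_eqVlt; apply/orP; left; apply/eqP; apply: eq_integral => w _.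
by rewrite -EFinD /step_energy big_ord_recr/=; congr EFin; ring.
Qed.

Section Maximal.
Variables (K : nat -> Omega -> R) (delta eta : R) (n : nat).
Hypotheses (mK : predictable K) (delta0 : 0 < delta) (eta0 : 0 <= eta).

(** The coefficients are switched off as soon as the energy, which is known one step
    ahead, would exceed [eta], or the sum has reached [delta]. *)
Let alive i := [set w | step_energy K i.+1 w <= eta] `&`
  \bigcap_(j in `I_i.+1) [set w | `|step_integral K j w| < delta].

Let K' i (w : Omega) : R := K i w * \1_(alive i) w.

Let alive_measurable i : F (tau i) (alive i).
Proof.
have -> : F (tau i) = (measurable : set (set (g_sigma_algebraType (F (tau i))))).
  by rewrite [RHS]/measurable/= (sigma_algebra_id (sF i)).
apply: measurableI.
  rewrite (_ : [set _ | _] = step_energy K i.+1 @^-1` `]-oo, eta]%classic); last first.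
    by apply/seteqP; split=> w /=; rewrite in_itv.
  have /(measurable_wrtP _ (sF i)) mE := step_energy_measurable i.+1 mK.
  by rewrite -[X in measurable X]setTI; exact: mE.
apply: bigcap_measurable; first by exists 0%N.
move=> j /= ji; rewrite (_ : [set _ | _] =
  (Num.norm \o step_integral K j) @^-1` `]-oo, delta[%classic); last first.
  by apply/seteqP; split=> w /=; rewrite in_itv.
have : measurable_wrt (F (tau i)) (step_integral K j) by apply: (@mle j);
  [rewrite -ltnS|exact: step_integral_measurable].
move=> /(measurable_wrtP _ (sF i)) /(measurableT_comp (@normr_measurable R setT)) mn.
by rewrite -[X in measurable X]setTI; exact: mn.
Qed.

Let mK' : predictable K'.
Proof.
move=> i; apply/(measurable_wrtP _ (sF i)); apply: measurable_funM.
  exact/measurable_wrtP.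
apply: measurable_indic.
by have := alive_measurable i; rewrite /measurable/= (sigma_algebra_id (sF i)).
Qed.

(** The two bounds are proved together: [eta] bounds the energy at the last step that is
    not switched off. *)
Let stopped_energy w k : step_energy K' k w <= eta /\ step_energy K' k w <= step_energy K k w.
Proof.
elim: k => [|k [IH1 IH2]]; first by rewrite /step_energy !big_ord0.
rewrite {1 2}/step_energy !big_ord_recr/= -/(step_energy K' k w).
have [wk|wk] := boolP (w \in alive k).
  rewrite /K' indicE wk mulr1.
  have /set_mem[/= h _] := wk.
  move: (h); rewrite {1}/step_energy big_ord_recr/= -/(step_energy K k w) => h'.
  split; first by apply: (le_trans _ h'); rewrite lerD2r.
  by rewrite [leRHS]/step_energy big_ord_recr/= lerD2r.
rewrite /K' indicE (negbTE wk) mulr0 expr0n/= mul0r addr0; split => //.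
by rewrite [leRHS]/step_energy big_ord_recr/= (le_trans IH2)// lerDl mulr_ge0 ?sqr_ge0.
Qed.

(** Once the sum has reached [delta] it is frozen there, so that the maximal event is
    detected by the final value of the stopped sum. *)
Let stopped_step_integral w : step_energy K n w <= eta -> forall k, (k <= n)%N ->
  ((forall j, (j < k)%N -> `|step_integral K j w| < delta) ->
    step_integral K' k w = step_integral K k w) /\
  ((exists2 j, (j <= k)%N & delta <= `|step_integral K j w|) ->
    delta <= `|step_integral K' k w|).
Proof.
move=> Qn; elim=> [|k IH] kn.
  by split=> [_|[[|//] _]]; rewrite /step_integral !big_ord0.
have [IH1 IH2] := IH (ltnW kn).
have Qk : step_energy K k.+1 w <= eta.
  apply: le_trans Qn; rewrite /step_energy -(subnKC kn) big_split_ord/= lerDl.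
  by apply: sumr_ge0 => i _; rewrite mulr_ge0 ?sqr_ge0.
have H1 : (forall j, (j < k.+1)%N -> `|step_integral K j w| < delta) ->
  step_integral K' k.+1 w = step_integral K k.+1 w.
  move=> Hj; rewrite /step_integral !big_ord_recr/= -/(step_integral K' k w) -/(step_integral
    K k w).
  rewrite IH1; last by move=> j jk; apply: Hj; exact: ltnW.
  by rewrite /K' indicE mem_set ?mulr1//; split.
split=> // -[j jk dj].
have [[i ik di]|Hn] := pselect (exists2 i, (i <= k)%N & delta <= `|step_integral K i w|).
  rewrite /step_integral big_ord_recr/= -/(step_integral K' k w) /K' indicE memNset ?mulr0
    ?mul0r ?addr0.
    by apply: IH2; exists i.
  by move=> [_ /(_ i)]/=; rewrite ltnS => /(_ ik); rewrite ltNge di.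
have jE : j = k.+1.
  apply/eqP; rewrite eqn_leq jk ltnNge; apply/negP => jk'; apply: Hn; by exists j.
rewrite H1 -?jE// => i ik; rewrite ltNge; apply/negP => di; apply: Hn; exists i => //.
by rewrite -ltnS -jE.
Qed.

(** On the event that the energy is at most [eta], the stopped sum decides; its second moment
    is at most [16 * eta], and Markov's inequality applies. *)
Lemma step_integral_maximal :
  (P [set w | exists2 j, (j <= n)%N & delta <= `|step_integral K j w|]%R <=
   P [set w | eta < step_energy K n w]%R + (16 * eta / delta ^+ 2)%:E)%E.
Proof.
have mS' := measurable_wrt_measurable (@FM n) (step_integral_measurable n mK').
have mE : measurable_fun setT (step_energy K n) :=
  measurable_wrt_measurable (@FM n.-1) (step_energy_measurable n mK).
have mE' : measurable_fun setT (step_energy K' n) :=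
  measurable_wrt_measurable (@FM n.-1) (step_energy_measurable n mK').
have mA : measurable [set w | eta < step_energy K n w].
  rewrite (_ : [set _ | _] = step_energy K n @^-1` `]eta, +oo[%classic).
    by rewrite -[X in measurable X]setTI; exact: mE.
  by apply/seteqP; split=> w /=; rewrite in_itv/= andbT.
have mge (f : Omega -> R) : measurable_fun setT f -> measurable [set w | delta <= `|f w|].
  move=> mf; rewrite (_ : [set _ | _] = (Num.norm \o f) @^-1` `[delta, +oo[%classic).
    rewrite -[X in measurable X]setTI; exact: (measurableT_comp (@normr_measurable R setT) mf).
  by apply/seteqP; split=> w /=; rewrite in_itv/= andbT.
have mB := mge _ mS'.
apply: (@le_trans _ _ (P ([set w | eta < step_energy K n w] `|` [set w | delta <=
  `|step_integral K' n w|]))).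
  apply: le_measure; rewrite ?inE.
  - rewrite (_ : [set _ | _] = \bigcup_(j in `I_n.+1) [set w | delta <=
    `|step_integral K j w|]).
      apply: bigcup_measurable => j _; apply: mge.
      exact: measurable_wrt_measurable (@FM j) (step_integral_measurable j mK).
    by apply/seteqP; split=> w [j jn dj]; exists j.
  - exact: measurableU.
  - move=> w [j jn dj]; have [h|h] := leP (step_energy K n w) eta; last by left.
    by right; have [_] := stopped_step_integral h (leqnn n); apply; exists j.
apply: (le_trans (measureU2 _ _ _)) => //; apply: leeD2l.
have d2 : 0 < delta ^+ 2 by rewrite exprn_gt0.
rewrite -(@lee_pmul2l _ (delta ^+ 2)%:E)// -EFinM mulrCA divff ?gt_eqF// mulr1.
apply: (@le_trans _ _ (\int[P]_w (step_integral K' n w ^+ 2)%:E)%E).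
  rewrite -[X in (_ * P X)%E]setIT -integral_indic// -ge0_integralZl//=; last 2 first.
  - by apply/measurable_EFinP; exact: measurable_indic.
  - by rewrite lee_fin ltW.
  apply: ge0_le_integral => //.
  - by move=> w _; rewrite -EFinM lee_fin mulr_ge0// ltW.
  - by apply/measurable_EFinP; apply: measurable_funM => //; exact: measurable_indic.
  - by apply/measurable_EFinP; exact: measurable_funX.
  - move=> w _; rewrite -EFinM lee_fin indicE; case: (boolP (w \in _)) => [/set_mem/= h|_];
    last first.
      by rewrite mulr0 sqr_ge0.
    by rewrite mulr1 -(@real_normK _ (step_integral K' n w)) ?num_real// ler_pXn2r ?nnegrE//
      ltW.
apply: (le_trans (step_integral_sqr_le n mK')).
apply: (@le_trans _ _ (\int[P]_w (16 * eta)%:E)%E); last first.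
  by rewrite integral_cst//= probability_setT mule1.
apply: ge0_le_integral => //.
- by move=> w _; rewrite lee_fin mulr_ge0//; apply: sumr_ge0 => i _; rewrite mulr_ge0 ?sqr_ge0.
- by apply/measurable_EFinP; exact: measurable_funM.
- by move=> w _; rewrite lee_fin ler_wpM2l//; have [] := stopped_energy w n.
Qed.

End Maximal.
End DiscreteIntegral.

(** * Simple processes on a common grid *)

Section Refinement.
Context {R : realType} {d : measure_display} {Omega : measurableType d}.
Variables (P : probability Omega R) (T : R) (F : R -> set (set Omega)).
Variable W : R -> Omega -> R.
Hypotheses (F_filtration : filtration F T) (W_brownian : brownian_motion P F T W).
Implicit Types H : simple_process F T.
Notation mu := (@lebesgue_measure R).

Definition sp_times H : seq R := [seq sp_time H i | i <- iota 0 (sp_size H).+1].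

Lemma sp_time_mono H i j : (i <= j <= sp_size H)%N -> sp_time H i <= sp_time H j.
Proof.
move=> /andP[ij]; rewrite -(subnKC ij); elim: (j - i)%N => [|k IH]; first by rewrite addn0.
by rewrite addnS => h; apply: le_trans (sp_time_le h); apply: IH; exact: ltnW.
Qed.

Lemma sp_time_itv H i : (i <= sp_size H)%N -> 0 <= sp_time H i <= T.
Proof.
move=> iH; rewrite (le_trans (sp_time_ge0 H)) ?sp_time_mono//=.
by rewrite (le_trans _ (sp_time_leT H))// sp_time_mono// iH /=.
Qed.

Section Grid.
Variable tau : nat -> R.
Hypothesis tau_itv : forall i, 0 <= tau i <= T.
Hypothesis tau_le : forall i, tau i <= tau i.+1.

Let tau_mono i j : (i <= j)%N -> tau i <= tau j.
Proof. by move=> ij; apply: (@homo_leq _ tau (fun x y => x <= y)) => //; exact: le_trans. Qed.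

Let tau_lt i j : tau i < tau j -> (i < j)%N.
Proof. by move=> h; rewrite ltnNge; apply/negP => /tau_mono; rewrite leNgt h. Qed.

(** The summands are the increments of [G] along the grid clipped to the interval from
    [tau p] to [tau q]. *)
Lemma telescope_grid (G : R -> R) (p q k : nat) : (p <= q <= k)%N ->
  \sum_(i < k) \1_`]tau p, tau q] (tau i.+1) * (G (tau i.+1) - G (tau i)) =
    G (tau q) - G (tau p).
Proof.
move=> /andP[pq qk].
pose cl i := maxn p (minn i q).
rewrite (eq_bigr (fun i : 'I_k => G (tau (cl i.+1)) - G (tau (cl i)))).
  rewrite -(big_mkord xpredT (fun i => G (tau (cl i.+1)) - G (tau (cl i)))).
  rewrite telescope_sumr// /cl min0n maxn0 (minn_idPr qk).
  by rewrite (maxn_idPr pq).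
move=> i _; rewrite indicE mem_setE in_itv/=.
have [h1|h1] := ltP (tau p) (tau i.+1); last first.
  rewrite mul0r.
  have : tau (cl i.+1) = tau (cl i).
    rewrite /cl; have [pi|ip] := leqP p i; last first.
      by rewrite (maxn_idPl _) ?(maxn_idPl _)// geq_min ?(ltnW ip) ?ip.
    have tE : tau i.+1 = tau i.
      by apply: le_anti; rewrite tau_le andbT (le_trans h1)// tau_mono.
    have [iq|qi] := ltnP i q.
      by rewrite ?(minn_idPl iq) ?(minn_idPl (ltnW iq)) ?(maxn_idPr (leqW pi)) ?(maxn_idPr pi).
    by rewrite ?(minn_idPr qi) ?(minn_idPr (leqW qi)).
  by move=> ->; rewrite subrr.
have pi : (p <= i)%N by rewrite -ltnS; exact: tau_lt.
have [h2|h2] := leP (tau i.+1) (tau q); last first.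
  have qi : (q <= i)%N by rewrite -ltnS; exact: tau_lt.
  by rewrite mul0r /cl ?(minn_idPr qi) ?(minn_idPr (leqW qi)) subrr.
rewrite mul1r /cl.
have [iq|qi] := ltnP i q.
  by rewrite ?(minn_idPl iq) ?(minn_idPl (ltnW iq)) ?(maxn_idPr (leqW pi)) ?(maxn_idPr pi).
rewrite ?(minn_idPr qi) ?(minn_idPr (leqW qi)) subrr.
have -> : tau i.+1 = tau i; last by rewrite subrr.
by apply: le_anti; rewrite tau_le andbT (le_trans h2)// tau_mono.
Qed.

Definition on_grid H := forall j, (j <= sp_size H)%N -> exists p, sp_time H j = tau p.

(** A simple process is constant on each interval of the grid without its left endpoint,
    so that its value there is read off at the right endpoint. *)
Definition grid_coef H (i : nat) : Omega -> R := sp_val H (tau i.+1).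

Lemma sp_integral_grid H k w : on_grid H ->
  sp_integral H W (tau k) w = step_integral W tau (grid_coef H) k w.
Proof.
move=> Hg; rewrite /sp_integral /step_integral /grid_coef /sp_val.
under [RHS]eq_bigr do rewrite mulr_suml.
rewrite exchange_big/=; apply: eq_bigr => j _.
under eq_bigr do rewrite -mulrA.
rewrite -mulr_sumr; congr (_ * _).
have jH : (j < sp_size H)%N by [].
have [p pE] := Hg j (ltnW jH); have [q qE] := Hg j.+1 jH.
have pq : tau p <= tau q by rewrite -pE -qE sp_time_le.
pose p' := minn p k; pose q' := maxn p' (minn q k).
have p'E : Num.min (tau p) (tau k) = tau p'.
  rewrite /p'; have [pk|kp] := leqP p k; first by rewrite (min_idPl (tau_mono pk)).
  by rewrite (min_idPr (tau_mono (ltnW kp))).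
have q'E : Num.min (tau q) (tau k) = tau q'.
  rewrite /q' /p'; have [qp|qp] := leqP p q.
    have -> : maxn (minn p k) (minn q k) = minn q k.
      by apply/maxn_idPr; rewrite leq_min geq_minr andbT (leq_trans (geq_minl _ _)).
    have [pk|kp] := leqP q k; first by rewrite (min_idPl (tau_mono pk)).
    by rewrite (min_idPr (tau_mono (ltnW kp))).
  have qpE : tau q = tau p by apply: le_anti; rewrite pq tau_mono// ltnW.
  rewrite qpE; have -> : maxn (minn p k) (minn q k) = minn p k.
    by apply/maxn_idPl; rewrite leq_min geq_minr andbT (leq_trans (geq_minl _ _))// ltnW.
  exact: p'E.
rewrite qE pE p'E q'E.
rewrite -(@telescope_grid (W^~ w) p' q' k); last first.
  by rewrite leq_maxl/= geq_max !geq_minr.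
apply: eq_bigr => i _; congr (_ * _).
rewrite !indicE !mem_setE !in_itv/= -p'E -q'E; congr ((_ : bool)%:R).
have ik : tau i.+1 <= tau k by rewrite tau_mono.
by rewrite gt_min le_min ik andbT (ltNge (tau k)) ik orbF.
Qed.

(** A coefficient of index [j] occurs at [tau i.+1] only if [sp_time H j < tau i.+1]; as
    [sp_time H j] lies on the grid, it is then at most [tau i]. *)
Lemma grid_coef_predictable H : on_grid H -> predictable F tau (grid_coef H).
Proof.
move=> Hg i; have sFi := filtration_sigma F_filtration (tau_itv i).
apply/(measurable_wrtP _ sFi); rewrite /grid_coef /sp_val.
apply: (@measurable_sum _ (g_sigma_algebraType (F (tau i))) R setT) => j.
have jH : (j < sp_size H)%N by [].
have [p pE] := Hg j (ltnW jH).
rewrite indicE mem_setE in_itv/=.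
have [h|h] := ltP (sp_time H j) (tau i.+1); last first.
  by rewrite (_ : (fun _ => _) = cst 0)//; apply/funext => w; rewrite mulr0.
apply: measurable_funM => //; apply/(measurable_wrtP _ sFi).
apply: (measurable_wrt_le F_filtration _ _ _ (sp_coef_measurable jH)).
- by case/andP: (sp_time_itv (ltnW jH)).
- by rewrite pE tau_mono// -ltnS; apply: tau_lt; rewrite -pE.
- by case/andP: (tau_itv i).
Qed.

Lemma sp_val_grid H i (s : R) w : on_grid H -> tau i < s <= tau i.+1 ->
  sp_val H s w = grid_coef H i w.
Proof.
move=> Hg /andP[is_ si]; rewrite /grid_coef /sp_val; apply: eq_bigr => j _.
have jH : (j < sp_size H)%N by [].
have [p pE] := Hg j (ltnW jH); have [q qE] := Hg j.+1 jH.
congr (_ * _); rewrite !indicE !mem_setE !in_itv/= pE qE; congr ((_ : bool)%:R).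
congr (_ && _).
  apply/idP/idP => [h|/tau_lt h]; first exact: lt_le_trans si.
  by apply: le_lt_trans is_; apply: tau_mono; rewrite -ltnS.
apply/idP/idP => [h|h]; last exact: le_trans h.
by apply: tau_mono; apply: tau_lt; exact: lt_le_trans h.
Qed.

Lemma measurable_sp_val H w : measurable_fun setT (fun s => sp_val H s w).
Proof.
by apply: measurable_sum => j; apply: measurable_funM.
Qed.

Lemma step_energy_le_integral (K : R -> Omega -> R) n w : 
  measurable_fun setT (K^~ w) ->
  (forall i (s : R), tau i < s <= tau i.+1 -> K s w = K (tau i.+1) w) ->
  ((step_energy tau (fun i => K (tau i.+1)) n w)%:E <=
    \int[mu]_(s in `[0%R, T]) (K s w ^+ 2)%:E)%E.
Proof.
move=> mK KE.
have mK2 (D : set R) : measurable_fun D (fun s => (K s w ^+ 2)%:E).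
  by apply: measurable_funTS; apply/measurable_EFinP; exact: measurable_funX.
apply: (@le_trans _ _ (\int[mu]_(s in `]tau 0%N, tau n]) (K s w ^+ 2)%:E)%E); last first.
  apply: ge0_subset_integral => //; first exact: mK2.
  - by move=> s _; rewrite lee_fin sqr_ge0.
  - move=> s /=; rewrite !in_itv/= => /andP[h1 h2].
    have /andP[t0 _] := tau_itv 0; have /andP[_ tT] := tau_itv n.
    by rewrite (le_trans t0 (ltW h1)) (le_trans h2).
rewrite le_eqVlt; apply/orP; left; apply/eqP.
elim: n => [|n IH].
  by rewrite /step_energy big_ord0 set_itvoc0 integral_set0.
rewrite (_ : `]tau 0%N, tau n.+1]%classic = `]tau 0%N, tau n] `|` `]tau n, tau n.+1]);
  last first.
  by rewrite -itv_bndbnd_setU// bnd_simp tau_mono.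
rewrite ge0_integral_setU//=; last 3 first.
- exact: mK2.
- by move=> s _; rewrite lee_fin sqr_ge0.
- apply/disj_setPRL => s /=; rewrite !in_itv/= => /andP[h _] /andP[_]; by rewrite leNgt h.
rewrite -IH /step_energy big_ord_recr/= EFinD; congr (_ + _)%E.
rewrite (eq_integral (fun=> (K (tau n.+1) w ^+ 2)%:E)); last first.
  by move=> s; rewrite inE/= in_itv/= => sn; rewrite (KE n).
rewrite integral_cst//= lebesgue_measure_itv/= lte_fin.
have := tau_le n; rewrite le_eqVlt => /predU1P[<-|->]; last by rewrite EFinM.
by rewrite ltxx subrr !mulr0 mule0.
Qed.

End Grid.
End Refinement.

(** * Comparison of integrals of simple processes *)

Section ItoClose.
Context {R : realType} {d : measure_display} {Omega : measurableType d}.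
Variables (P : probability Omega R) (T : R) (F : R -> set (set Omega)).
Variable W : R -> Omega -> R.
Hypotheses (F_filtration : filtration F T) (W_brownian : brownian_motion P F T W).
Hypothesis T0 : 0 <= T.
Implicit Types H : simple_process F T.
Notation mu := (@lebesgue_measure R).

(** The default value [T] of [nth] prolongs the sorted list to an infinite nondecreasing
    sequence. *)
Lemma sorted_grid (s : seq R) : (forall x, x \in s -> 0 <= x <= T) ->
  exists tau : nat -> R, exists N, [/\ forall i, 0 <= tau i <= T,
    forall i, tau i <= tau i.+1 &
    forall x, x \in s -> exists2 p, (p <= N)%N & x = tau p].
Proof.
move=> sT; pose s' := sort <=%R s.
have s'T x : x \in s' -> 0 <= x <= T by rewrite mem_sort; exact: sT.
exists (fun i => nth T s' i), (size s'); split.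
- move=> i; have [h|h] := ltnP i (size s'); first by apply: s'T; exact: mem_nth.
  by rewrite nth_default// T0 lexx.
- move=> i; have [h|h] := ltnP i.+1 (size s'); last first.
    rewrite [leRHS]nth_default//; have [h'|h'] := ltnP i (size s').
      by have /andP[] := s'T _ (mem_nth T h').
    by rewrite nth_default.
  have : sorted <=%R s' by apply: sort_sorted; exact: le_total.
  by move/(sortedP T); apply.
- move=> x; rewrite -(mem_sort <=%R) -/s' => xs; exists (index x s'); first exact: index_size.
  by rewrite nth_index.
Qed.

Lemma measurable_sp_integral H (t : R) : 0 <= t <= T ->
  measurable_wrt (F t) (sp_integral H W t).
Proof.
move=> tT; have sFt := filtration_sigma F_filtration tT.
have /andP[t0 tT'] := tT.
apply/(measurable_wrtP _ sFt).
apply: (@measurable_sum _ (g_sigma_algebraType (F t)) R setT) => j.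
have jH : (j < sp_size H)%N by [].
have mW u : 0 <= u <= T -> u <= t -> measurable_fun setT (W u : g_sigma_algebraType (F t) -> R).
  move=> uT ut; apply/(measurable_wrtP _ sFt); have /andP[u0 _] := uT.
  exact: (measurable_wrt_le F_filtration u0 ut tT' (brownian_adapted W_brownian uT)).
have /andP[j0 jT] := sp_time_itv (ltnW jH); have /andP[j10 j1T] := sp_time_itv jH.
have [h|h] := leP t (sp_time H j).
  rewrite (_ : (fun _ => _) = cst 0)//; apply/funext => w.
  by rewrite (min_idPr _) ?subrr ?mulr0// (le_trans h)// sp_time_le.
apply: measurable_funM.
  apply/(measurable_wrtP _ sFt).
  exact: (measurable_wrt_le F_filtration j0 (ltW h) tT' (sp_coef_measurable jH)).
have mn a : 0 <= a -> measurable_fun setT (W (Num.min a t) : g_sigma_algebraType (F t) -> R).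
  by move=> a0; apply: mW; [rewrite le_min a0 t0 ge_min tT' orbT|rewrite ge_min lexx orbT].
by apply: measurable_funB; [exact: (mn _ j10)|apply: mW; [rewrite j0|exact: ltW]].
Qed.

Variable Hc : R -> Omega -> R.
Hypotheses (Hc_continuous : forall w, continuous (Hc^~ w))
  (Hc_measurable : forall s, measurable_fun setT (Hc s)).

Definition sqdist H (w : Omega) : \bar R :=
  (\int[mu]_(s in `[0%R, T]) ((sp_val H s w - Hc s w) ^+ 2)%:E)%E.

Lemma sqdist_ge0 H w : (0 <= sqdist H w)%E.
Proof. by apply: integral_ge0 => s _; rewrite lee_fin sqr_ge0. Qed.

Lemma measurable_sqdist H : measurable_fun setT (sqdist H).
Proof.
apply: (@measurable_integral _ _ _ (fun p => (sp_val H p.1 p.2 - Hc p.1 p.2) ^+ 2)) => //.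
  apply: measurable_funX; apply: measurable_funB; last exact: measurable_caratheodory.
  rewrite /sp_val; apply: measurable_sum => j; apply: measurable_funM; last first.
    by apply: measurableT_comp => //; exact: measurable_indic.
  have jH : (j < sp_size H)%N by [].
  apply: (@measurableT_comp _ _ _ _ _ _ (sp_coef H j)) => //.
  have := sp_coef_measurable jH.
  by apply: measurable_wrt_measurable; apply: filtration_sub;
    [exact: F_filtration|exact: sp_time_itv (ltnW jH)].
by move=> p; rewrite sqr_ge0.
Qed.

Lemma measurable_sqdist_ge H (e : R) : measurable [set w | (e%:E <= sqdist H w)%E].
Proof.
by have := emeasurable_fun_c_infty measurableT (measurable_sqdist H) e%:E; rewrite setTI.
Qed.

Lemma integral_sqr_diff_le H1 H2 w :
  (\int[mu]_(s in `[0%R, T]) ((sp_val H1 s w - sp_val H2 s w) ^+ 2)%:E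
    <= 2%:E * sqdist H1 w + 2%:E * sqdist H2 w)%E.
Proof.
have mv H : measurable_fun `[0, T] (fun s => ((sp_val H s w - Hc s w) ^+ 2)%:E).
  apply: measurable_funTS; apply/measurable_EFinP; apply: measurable_funX.
  by apply: measurable_funB; [exact: measurable_sp_val|exact: continuous_measurable_fun].
rewrite /sqdist -!ge0_integralZl//=;
  try by [exact: mv|move=> s _; rewrite lee_fin sqr_ge0].
have m2 H : measurable_fun `[0, T] (fun s => 2%:E * ((sp_val H s w - Hc s w) ^+ 2)%:E)%E.
  by apply: emeasurable_funM => //; exact: mv.
rewrite -ge0_integralD//=;
  try by [exact: m2|move=> s _; rewrite -EFinM lee_fin mulr_ge0 ?sqr_ge0].
apply: ge0_le_integral => //=.
- by move=> s _; rewrite lee_fin sqr_ge0.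
- apply: measurable_funTS; apply/measurable_EFinP; apply: measurable_funX.
  by apply: measurable_funB; exact: measurable_sp_val.
- by apply: emeasurable_funD; exact: m2.
- move=> s _; rewrite -!EFinM -EFinD lee_fin.
  have := sqr_ge0 (sp_val H1 s w - Hc s w + (sp_val H2 s w - Hc s w)); nra.
Qed.

(** On a grid containing [s] and the times of both processes, the maximal inequality holds
    with energy at most [2 sqdist H1 + 2 sqdist H2]; this is below [4 * eta] unless one of
    the two distances reaches [eta]. *)
Lemma sp_integral_close H1 H2 (s : seq R) (delta eta : R) : 0 < delta -> 0 < eta ->
  (forall t, t \in s -> 0 <= t <= T) ->
  (P [set w | exists2 t, t \in s & delta <= `|sp_integral H1 W t w - sp_integral H2 W t w|]%R
   <= P [set w | (eta%:E <= sqdist H1 w)%E] + P [set w | (eta%:E <= sqdist H2 w)%E]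
      + (64 * eta / delta ^+ 2)%:E)%E.
Proof.
move=> delta0 eta0 sT.
have [|tau [N [tau_itv tau_le tauP]]] := @sorted_grid (sp_times H1 ++ sp_times H2 ++ s).
  move=> x; rewrite !mem_cat => /or3P[/mapP[i]|/mapP[i]|]; last exact: sT.
  - by rewrite mem_iota add0n ltnS => /= iH ->; exact: sp_time_itv.
  - by rewrite mem_iota add0n ltnS => /= iH ->; exact: sp_time_itv.
have g1 : on_grid tau H1.
  move=> j jH; have [|p _ ->] := tauP (sp_time H1 j); last by exists p.
  by rewrite mem_cat map_f// mem_iota.
have g2 : on_grid tau H2.
  move=> j jH; have [|p _ ->] := tauP (sp_time H2 j); last by exists p.
  by rewrite !mem_cat (map_f (sp_time H2))// ?mem_iota// orbT.
pose K r w := sp_val H1 r w - sp_val H2 r w.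
pose K' i := K (tau i.+1).
have mK' : predictable F tau K'.
  move=> i; have sFi := filtration_sigma F_filtration (tau_itv i).
  apply/(measurable_wrtP _ sFi).
  apply: measurable_funB; apply/(measurable_wrtP _ sFi).
    exact: (grid_coef_predictable F_filtration tau_itv tau_le g1).
  exact: (grid_coef_predictable F_filtration tau_itv tau_le g2).
have dintE k w : step_integral W tau K' k w =
  sp_integral H1 W (tau k) w - sp_integral H2 W (tau k) w.
  rewrite !(sp_integral_grid W tau_le)// /step_integral -sumrB; apply: eq_bigr => i _.
  by rewrite -mulrBl.
have mdint k : measurable_fun setT (step_integral W tau K' k).
  exact: (measurable_wrt_measurable (filtration_sub F_filtration (tau_itv k))
    (step_integral_measurable F_filtration W_brownian tau_itv tau_le k mK')).
have menergy : measurable_fun setT (step_energy tau K' N).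
  exact: (measurable_wrt_measurable (filtration_sub F_filtration (tau_itv N.-1))
    (step_energy_measurable F_filtration tau_itv tau_le N mK')).
have mge (f : Omega -> R) : measurable_fun setT f -> measurable [set w | delta <= `|f w|].
  move=> mf; rewrite (_ : [set _ | _] = (Num.norm \o f) @^-1` `[delta, +oo[%classic).
    rewrite -[X in measurable X]setTI; exact: (measurableT_comp (@normr_measurable R setT) mf).
  by apply/seteqP; split=> w /=; rewrite in_itv/= andbT.
have mI t : 0 <= t <= T -> measurable [set w | delta <=
  `|sp_integral H1 W t w - sp_integral H2 W t w|].
  move=> tT; apply: mge; have sub := filtration_sub F_filtration tT.
  apply: measurable_funB; first exact:
    (measurable_wrt_measurable sub (measurable_sp_integral H1 tT)).
  exact: (measurable_wrt_measurable sub (measurable_sp_integral H2 tT)).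
have eta40 : 0 <= 4 * eta by rewrite mulr_ge0// ltW.
apply: (@le_trans _ _ (P [set w | exists2 j, (j <= N)%N & delta <=
  `|step_integral W tau K' j w|])).
  apply: le_measure; rewrite ?inE.
  - rewrite (_ : [set _ | _] = \bigcup_(t in [set` s]) [set w | delta <=
    `|sp_integral H1 W t w - sp_integral H2 W t w|]).
      by apply: fin_bigcup_measurable => // t /= ts; apply: mI; exact: sT.
    by apply/seteqP; split=> w [t ts h]; exists t.
  - rewrite (_ : [set _ | _] = \bigcup_(j in `I_N.+1) [set w | delta <=
    `|step_integral W tau K' j w|]).
      by apply: bigcup_measurable => j _; exact: mge.
    by apply/seteqP; split=> w [t ts h]; exists t.
  - move=> w [t ts h]; have [|p pN tE] := tauP t; first by rewrite !mem_cat ts !orbT.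
    by exists p => //; rewrite dintE -tE.
apply: (le_trans (step_integral_maximal F_filtration W_brownian tau_itv tau_le N mK' delta0
  eta40)).
have -> : 16 * (4 * eta) / delta ^+ 2 = 64 * eta / delta ^+ 2 :> R by ring.
apply: leeD2r.
have mZ H := measurable_sqdist_ge H eta.
apply: (le_trans _ (measureU2 _ (mZ H1) (mZ H2))).
apply: le_measure; rewrite ?inE.
- rewrite (_ : [set _ | _] = step_energy tau K' N @^-1` `]4 * eta, +oo[%classic).
    by rewrite -[X in measurable X]setTI; exact: menergy.
  by apply/seteqP; split=> w /=; rewrite in_itv/= andbT.
- exact: measurableU.
move=> w /= hw.
have [h1|h1] := leP eta%:E (sqdist H1 w); first by left.
have [h2|h2] := leP eta%:E (sqdist H2 w); first by right.
exfalso.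
have : ((4 * eta)%:E < (4 * eta)%:E :> \bar R)%E.
  apply: (@lt_le_trans _ _ (step_energy tau K' N w)%:E); first by rewrite lte_fin.
  apply: (@le_trans _ _ (\int[mu]_(r in `[0%R, T]) (K r w ^+ 2)%:E)%E).
    apply: (step_energy_le_integral tau_itv tau_le).
      by apply: measurable_funB; exact: measurable_sp_val.
    move=> i r ri; rewrite /K.
    by rewrite (sp_val_grid tau_le w g1 ri) (sp_val_grid tau_le w g2 ri).
  apply: (le_trans (integral_sqr_diff_le H1 H2 w)).
  have -> : (4 * eta)%:E = (2%:E * eta%:E + 2%:E * eta%:E)%E by rewrite -!EFinM -EFinD;
    congr EFin; ring.
  by apply: leeD; apply: lee_pmul => //; rewrite ?sqdist_ge0 ?lee_fin// ltW.
by rewrite ltxx.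
Qed.

End ItoClose.

(** * Uniqueness of the stochastic integral *)

Lemma continuous_le_rat {R : realType} (f : R -> R) (e : R) : continuous f ->
  (forall q : rat, f (ratr q) <= e) -> forall t, f t <= e.
Proof.
move=> cf fe t; rewrite leNgt; apply/negP => et.
have := @dense_rat R (f @^-1` `]e, +oo[%classic).
case; first by exists t; rewrite /= in_itv/= et.
  by apply: open_comp; [move=> x _; exact: cf|exact: interval_open].
by move=> x [/=]; rewrite in_itv/= andbT => ex [q _ qx]; move: ex; rewrite ltNge -qx fe.
Qed.

Section ItoUnique.
Context {R : realType} {d : measure_display} {Omega : measurableType d}.
Variables (P : probability Omega R) (T : R) (F : R -> set (set Omega)).
Variable W : R -> Omega -> R.
Hypotheses (F_filtration : filtration F T) (W_brownian : brownian_motion P F T W).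
Hypothesis T0 : 0 <= T.
Notation mu := (@lebesgue_measure R).

Definition clamped (X : R -> Omega -> R) (t : R) (w : Omega) : R := X (clamp T t) w.

Lemma clamped_continuous (X : R -> Omega -> R) : continuous_process T X ->
  forall w, continuous ((clamped X)^~ w).
Proof. by move=> cX w; apply: (clamp_continuous_within T0 (cX w)). Qed.

Lemma clamped_measurable (X : R -> Omega -> R) : adapted F T X ->
  forall s, measurable_fun setT (clamped X s).
Proof.
move=> aX s; apply: (measurable_wrt_measurable (filtration_sub F_filtration (clamp_itv T0 s))).
exact: aX (clamp_itv T0 s).
Qed.

Lemma sqdist_clamped (X : R -> Omega -> R) (H : simple_process F T) w :
  (\int[mu]_(s in `[0%R, T]) ((sp_val H s w - X s w) ^+ 2)%:E)%E = sqdist (clamped X) H w.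
Proof.
by apply: eq_integral => s; rewrite inE/= in_itv/= => sT; rewrite /clamped clamp_id.
Qed.

Lemma cvg_in_probability0_lt (Z : nat -> Omega -> \bar R) (e r : R) :
  cvg_in_probability0 P Z -> 0 < e -> 0 < r ->
  \forall n \near \oo, (P [set w | (e%:E <= Z n w)%E] < r%:E)%E.
Proof.
move=> Zcvg e0 r0; apply: (Zcvg e e0 [set y | (y < r%:E)%E]).
apply: open_nbhs_nbhs; split; first exact: open_ereal_lt_ereal.
by rewrite /= lte_fin.
Qed.

Lemma measurable_norm_ge (f : Omega -> R) (e : R) : measurable_fun setT f ->
  measurable [set w | e <= `|f w|].
Proof.
move=> mf; rewrite (_ : [set _ | _] = (Num.norm \o f) @^-1` `[e, +oo[%classic).
  rewrite -[X in measurable X]setTI; exact: (measurableT_comp (@normr_measurable R setT) mf).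
by apply/seteqP; split=> w /=; rewrite in_itv/= andbT.
Qed.

Lemma adapted_measurable (X : R -> Omega -> R) (t : R) : adapted F T X -> 0 <= t <= T ->
  measurable_fun setT (X t).
Proof.
by move=> aX tT; apply: (measurable_wrt_measurable (filtration_sub F_filtration tT)); exact: aX.
Qed.

(** Triangle inequality through the integrals of the two approximating sequences. *)
Lemma ito_unique_at (H J1 J2 : R -> Omega -> R) (t e : R) :
  continuous_process T H -> adapted F T H ->
  is_ito_integral P F T W H J1 -> is_ito_integral P F T W H J2 ->
  0 <= t <= T -> 0 < e -> P [set w | e <= `|J1 t w - J2 t w|] = 0%E.
Proof.
move=> cH aH [cJ1 aJ1 [G1 [Z1 I1]]] [cJ2 aJ2 [G2 [Z2 I2]]] tT e0.
have e30 : 0 < e / 3 by rewrite divr_gt0.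
apply/eqP; rewrite eq_le measure_ge0 andbT; apply/lee_addgt0Pr => r r0; rewrite add0e.
pose r' := r / 5; have r'0 : 0 < r' by rewrite divr_gt0.
(* this makes the last term of [sp_integral_close] equal to [r'] *)
pose eta := r' * (e / 3) ^+ 2 / 64.
have eta0 : 0 < eta by rewrite divr_gt0// mulr_gt0// exprn_gt0.
near \oo => n.
have h1 : (P [set w | (eta%:E <= sqdist (clamped H) (G1 n) w)%E] < r'%:E)%E.
  near: n; have := cvg_in_probability0_lt Z1 eta0 r'0.
  by apply: filterS => n; under eq_set do rewrite sqdist_clamped.
have h2 : (P [set w | (eta%:E <= sqdist (clamped H) (G2 n) w)%E] < r'%:E)%E.
  near: n; have := cvg_in_probability0_lt Z2 eta0 r'0.
  by apply: filterS => n; under eq_set do rewrite sqdist_clamped.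
have h3 : (P [set w | e / 3 <= `|J1 t w - sp_integral (G1 n) W t w|]%R < r'%:E)%E.
  by near: n; exact: (cvg_in_probability0_lt (I1 t tT) e30 r'0).
have h4 : (P [set w | e / 3 <= `|J2 t w - sp_integral (G2 n) W t w|]%R < r'%:E)%E.
  by near: n; exact: (cvg_in_probability0_lt (I2 t tT) e30 r'0).
have sub := filtration_sub F_filtration tT.
have mI (G : simple_process F T) : measurable_fun setT (sp_integral G W t).
  exact: (measurable_wrt_measurable sub (measurable_sp_integral F_filtration W_brownian G tT)).
have mJ1 := adapted_measurable aJ1 tT; have mJ2 := adapted_measurable aJ2 tT.
set A3 := [set w | _] in h3; set A4 := [set w | _] in h4.
pose A5 := [set w | e / 3 <= `|sp_integral (G1 n) W t w - sp_integral (G2 n) W t w|].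
have mA3 : measurable A3 by apply: measurable_norm_ge; exact: measurable_funB.
have mA4 : measurable A4 by apply: measurable_norm_ge; exact: measurable_funB.
have mA5 : measurable A5 by apply: measurable_norm_ge; exact: measurable_funB.
have h5 : (P A5 <= r'%:E + r'%:E + r'%:E)%E.
  have := sp_integral_close F_filtration W_brownian T0 (clamped_continuous cH)
    (clamped_measurable aH) (G1 n) (G2 n) (s := [:: t]) e30 eta0.
  have -> : [set w | exists2 t0, t0 \in [:: t] &
      e / 3 <= `|sp_integral (G1 n) W t0 w - sp_integral (G2 n) W t0 w|] = A5.
    by apply/seteqP; split=> w /=; [case=> t0; rewrite inE => /eqP->|exists t; rewrite ?inE].
  have -> : 64 * eta / (e / 3) ^+ 2 = r'.
    by rewrite /eta; field; rewrite gt_eqF.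
  move=> /(_ _)/le_trans; apply; first by move=> x; rewrite inE => /eqP ->.
  by apply: leeD2r; apply: leeD; exact: ltW.
apply: (@le_trans _ _ (P (A3 `|` A5 `|` A4))).
  apply: le_measure; rewrite ?inE.
  - by apply: measurable_norm_ge; exact: measurable_funB.
  - by apply: measurableU => //; exact: measurableU.
  - move=> w /= ew; have [h|h] := leP (e / 3) `|J1 t w - sp_integral (G1 n) W t w|;
    first by left; left.
    have [h'|h'] := leP (e / 3) `|J2 t w - sp_integral (G2 n) W t w|; first by right.
    left; right; rewrite /A5/= leNgt; apply/negP => h''.
    move: ew; apply/negP; rewrite -ltNge.
    set i1 := sp_integral (G1 n) W t w in h h''; set i2 := sp_integral (G2 n) W t w in h' h''.
    have -> : J1 t w - J2 t w = (J1 t w - i1) + (i1 - i2) - (J2 t w - i2) by ring.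
    apply: (le_lt_trans (ler_normB _ _)).
    have := ler_normD (J1 t w - i1) (i1 - i2).
    have : e = e / 3 + e / 3 + e / 3 by field.
    lra.
apply: (le_trans (measureU2 _ _ _)) => //; first exact: measurableU.
have -> : r%:E = (r'%:E + (r'%:E + r'%:E + r'%:E) + r'%:E)%E.
  by rewrite -!EFinD; congr EFin; rewrite /r'; field.
apply: leeD; last exact: ltW.
by apply: (le_trans (measureU2 _ _ _)) => //; apply: leeD => //; exact: ltW.
Unshelve. all: by end_near. Qed.

(** Almost surely the two integrals agree at all rational times, hence everywhere. *)
Lemma ito_unique (H J1 J2 : R -> Omega -> R) :
  continuous_process T H -> adapted F T H ->
  is_ito_integral P F T W H J1 -> is_ito_integral P F T W H J2 ->
  indistinguishable P T J1 J2.
Proof.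
move=> cH aH ito1 ito2; have [cJ1 aJ1 _] := ito1; have [cJ2 aJ2 _] := ito2.
pose q (n : nat) : rat := odflt 0 (unpickle n).
have H0 : forall n, \forall w \ae P,
    forall k, `|J1 (clamp T (ratr (q n))) w - J2 (clamp T (ratr (q n))) w| < k.+1%:R^-1.
  move=> n; apply: ae_foralln => k.
  have k0 : 0 < k.+1%:R^-1 :> R by rewrite invr_gt0.
  have cT := clamp_itv T0 (ratr (q n)).
  exists [set w | k.+1%:R^-1 <=
    `|J1 (clamp T (ratr (q n))) w - J2 (clamp T (ratr (q n))) w|]; split.
  - by apply: measurable_norm_ge; apply: measurable_funB; exact: adapted_measurable.
  - exact: (ito_unique_at cH aH ito1 ito2 cT k0).
  - by move=> w /= /negP; rewrite -leNgt.
have := ae_foralln H0; apply: filterS => w Hw t tT.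
apply/eqP; rewrite -subr_eq0 -normr_le0.
have cD : continuous (fun s => `|clamped J1 s w - clamped J2 s w|).
  move=> s; apply: cvg_norm; apply: cvgB; exact: clamped_continuous.
have := @continuous_le_rat _ _ 0 cD _ t.
rewrite /clamped clamp_id//; apply=> x.
have qx : q (pickle x) = x by rewrite /q pickleK.
apply/ler_addgt0Pr => e e0; rewrite add0r.
have /cvgrPdist_lt/(_ _ e0)[N _ HN] := @cvg_harmonic R.
have := HN N (leqnn _); rewrite /= sub0r normrN ger0_norm ?invr_ge0// => Ne.
by have := Hw (pickle x) N; rewrite qx => /lt_trans/(_ Ne)/ltW.
Qed.

End ItoUnique.

(** * Approximation by simple processes *)

Section Approximation.
Context {R : realType} {d : measure_display} {Omega : measurableType d}.
Variables (T : R) (F : R -> set (set Omega)).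
Hypotheses (F_filtration : filtration F T) (T0 : 0 <= T).
Variable H : R -> Omega -> R.
Hypotheses (cH : continuous_process T H) (aH : adapted F T H).
Notation mu := (@lebesgue_measure R).
Notation Hc := (clamped T H).

Definition equispaced (n i : nat) : R := i%:R * (T / n.+1%:R).

Lemma equispaced_itv n i : (i <= n.+1)%N -> 0 <= equispaced n i <= T.
Proof.
move=> iN; have Tn : 0 <= T / n.+1%:R by rewrite divr_ge0.
by rewrite /equispaced mulr_ge0//= mulrCA ler_piMr// ler_pdivrMr// mul1r ler_nat.
Qed.

Lemma equispaced_le n i : equispaced n i <= equispaced n i.+1.
Proof. by rewrite /equispaced ler_wpM2r ?divr_ge0// ler_nat. Qed.

(** The clipping makes the coefficients bounded; for a given path it is inactive when [n]
    is large. *)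
Program Definition riemann_process (n : nat) : simple_process F T :=
  @SimpleProcess _ _ _ F T n.+1 (equispaced n) (fun i w =>
    clip n%:R (Hc (equispaced n i) w)) _ _ _ _ _.
Next Obligation. by move=> n; rewrite /equispaced mul0r. Qed.
Next Obligation. by move=> n i _; exact: equispaced_le. Qed.
Next Obligation. by move=> n; rewrite /equispaced mulrC divfK// gt_eqF. Qed.
Next Obligation.
move=> n i _; exists n%:R => w; rewrite ler_norml; exact: clip_itv.
Qed.
Next Obligation.
move=> n i /= iN; have tT := equispaced_itv (ltnW iN).
have sF := filtration_sigma F_filtration tT.
apply/(measurable_wrtP _ sF).
have /(measurable_wrtP _ sF) : measurable_wrt (F (equispaced n i)) (Hc (equispaced n i)).
  by rewrite /clamped clamp_id//; exact: aH.
move=> mH; apply: measurable_maxr => //; exact: measurable_minr.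
Qed.

Lemma sp_val_riemann n (s : R) w : 0 < s <= T -> exists i,
  [/\ equispaced n i < s, s <= equispaced n i + T / n.+1%:R &
      sp_val (riemann_process n) s w = clip n%:R (Hc (equispaced n i) w)].
Proof.
move=> /andP[s0 sT].
have ex : exists i, s <= equispaced n i.+1.
  by exists n; rewrite /equispaced mulrC divfK// gt_eqF.
case: (ex_minnP ex) => i si imin; exists i.
have iN : (i < n.+1)%N by rewrite ltnS; apply: imin; rewrite /equispaced mulrC divfK// gt_eqF.
have is_ : equispaced n i < s.
  case: i {iN} si imin => [|i] si imin; first by rewrite /equispaced mul0r.
  by rewrite ltNge; apply/negP => /imin; rewrite ltnn.
have mono j k : (j <= k)%N -> equispaced n j <= equispaced n k.
  by move=> jk; rewrite /equispaced ler_wpM2r ?divr_ge0// ler_nat.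
split=> //.
  by move: si; rewrite /equispaced -natr1 mulrDl mul1r.
rewrite /sp_val/= (bigD1 (Ordinal iN))//= indicE mem_set ?mulr1/=;
  last by rewrite in_itv/= is_ si.
rewrite big1 ?addr0// => j ji; rewrite indicE memNset ?mulr0//= in_itv/= => /andP[h1 h2].
have : (j : nat) != i by apply: contra ji => /eqP ji; apply/eqP/val_inj.
rewrite neq_ltn => /orP[ij|ij].
  by move: (le_trans h2 (mono _ _ ij)); rewrite leNgt is_.
by move: (lt_le_trans h1 (le_trans si (mono _ _ ij))); rewrite ltxx.
Qed.

(** Dominated convergence: a path of [H] is continuous, hence bounded on the time interval, and the
    time at which it is sampled tends to [s]. *)
Lemma sqdist_riemann w : sqdist Hc (riemann_process n) w @[n --> \oo] --> 0%E.
Proof.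
have cHw : continuous (Hc^~ w) by exact: clamped_continuous.
have [M MP] : exists M : R, forall s, `|Hc s w| <= M.
  have /compact_bounded[M [_ MP]] : compact ((Hc^~ w) @` `[0, T]%classic).
    by apply: continuous_compact; [exact: continuous_subspaceT|exact: segment_compact].
  exists (`|M| + 1) => s; apply: MP; first by rewrite (le_lt_trans (ler_norm M))// ltrDl.
  exists (clamp T s); first by rewrite /= in_itv/= clamp_itv.
  by rewrite /clamped (clamp_id (clamp_itv T0 s)).
have M0 : 0 <= M by apply: le_trans (MP 0).
have sqdistE n : sqdist Hc (riemann_process n) w =
    (\int[mu]_(s in `]0%R, T]) ((sp_val (riemann_process n) s w - Hc s w) ^+ 2)%:E)%E.
  rewrite /sqdist integral_itv_obnd_cbnd//; apply: measurable_funTS.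
  apply/measurable_EFinP; apply: measurable_funX.
  by apply: measurable_funB; [exact: measurable_sp_val|exact: continuous_measurable_fun].
rewrite (funext sqdistE).
have -> : 0%E = (\int[mu]_(s in `]0%R, T]) (cst 0%E s))%E by rewrite integral0.
have [] // := @dominated_convergence _ _ R mu `]0, T]%classic _
  (fun n s => ((sp_val (riemann_process n) s w - Hc s w) ^+ 2)%:E) (cst 0%E)
  (cst ((2 * M) ^+ 2)%:E).
- move=> n; apply: measurable_funTS; apply/measurable_EFinP; apply: measurable_funX.
  by apply: measurable_funB; [exact: measurable_sp_val|exact: continuous_measurable_fun].
- apply/aeW => s /=; rewrite in_itv/= => sT; apply: cvg_EFin; first exact: nearW.
  rewrite [X in _ --> X](_ : _ = 0 ^+ 2); last by rewrite expr0n.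
  apply: (@cvg_comp _ _ _ (fun n => sp_val (riemann_process n) s w - Hc s w) (fun x =>
    x ^+ 2) _ (nbhs 0)); last exact: exprn_continuous.
  apply/cvgrPdist_le => e e0.
  have /cvgrPdist_le/(_ _ e0)/nbhs_ballP[r /= r0 Hr] := cHw s.
  near=> n; rewrite sub0r normrN.
  have [i [h1 h2 ->]] := sp_val_riemann n w sT.
  rewrite clip_id; last first.
    by apply: (le_trans (MP _)); near: n; exact: nbhs_infty_ger.
  rewrite distrC; apply: Hr; rewrite /ball/= ger0_norm ?subr_ge0 ?ltW//.
  apply: (@le_lt_trans _ _ (T / n.+1%:R)); first by rewrite lerBlDl.
  rewrite ltr_pdivrMr// mulrC -ltr_pdivrMr// -natr1.
  rewrite ltr_wpDr//; near: n; exact: nbhs_infty_gtr.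
- apply: integrableS (continuous_integrable 0 T (@cst_continuous _ _ ((2 * M) ^+ 2))) => //.
  exact: subset_itv_oc_cc.
- apply/aeW => s n /=; rewrite in_itv/= => sT;
  rewrite lee_fin normrX ler_sqr ?nnegrE ?mulr_ge0//.
  rewrite (le_trans (ler_normB _ _))// mulrDl mul1r lerD//.
  have [i [_ _ ->]] := sp_val_riemann n w sT.
  have [h|h] := leP `|Hc (equispaced n i) w| n%:R; first by rewrite clip_id.
  by apply: le_trans (MP (equispaced n i)); apply: le_trans (ltW h); rewrite ler_norml clip_itv.
Unshelve. all: by end_near. Qed.

End Approximation.

Section InProbability.
Context {R : realType} {d : measure_display} {Omega : measurableType d}.
Variable P : probability Omega R.

Lemma ae_cvg_in_probability0 (Z : nat -> Omega -> \bar R) :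
  (forall n, measurable_fun setT (Z n)) ->
  (\forall w \ae P, Z n w @[n --> \oo] --> 0%E) -> cvg_in_probability0 P Z.
Proof.
move=> mZ Z0 e e0.
pose A n := [set w | (e%:E <= Z n w)%E].
have mA n : measurable (A n).
  by have := emeasurable_fun_c_infty measurableT (mZ n) e%:E; rewrite setTI.
have PE n : P (A n) = (\int[P]_w (\1_(A n) w)%:E)%E by rewrite integral_indic// setIT.
rewrite (_ : (fun _ => _) = (fun n => \int[P]_w (\1_(A n) w)%:E)%E); last first.
  by apply/funext => n; rewrite -PE.
have -> : 0%E = (\int[P]_w (cst 0%E w))%E by rewrite integral0.
have [] // := @dominated_convergence _ _ R P setT measurableT
  (fun n w => (\1_(A n) w)%:E) (cst 0%E) (cst 1%E).
- by move=> n; apply/measurable_EFinP; exact: measurable_indic.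
- apply: filterS Z0 => w Zw _; apply: cvg_EFin; first exact: nearW.
  apply: cvg_near_cst.
  have := Zw [set y | (y < e%:E)%E]; rewrite /=.
  move=> H; have {H} : \forall n \near \oo, (Z n w < e%:E)%E.
    by apply: H; apply: open_nbhs_nbhs; split; [exact: open_ereal_lt_ereal|rewrite /= lte_fin].
  apply: filterS => n Zn; rewrite /= indicE memNset// /A/= => h.
  by move: (le_lt_trans h Zn); rewrite ltxx.
- by apply: finite_measure_integrable_cst.
- apply/aeW => w n _; rewrite lee_fin indicE; case: (_ \in _); rewrite ?normr1 ?normr0//.
Qed.

End InProbability.

(** * Existence of the stochastic integral *)

Lemma cvg_inv_expr {R : realType} (a b : R) : 1 < b -> a / b ^+ k @[k --> \oo] --> (0 : R).
Proof.
move=> b1; have b0 : 0 < b by rewrite (lt_trans _ b1).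
rewrite (_ : (fun k => _) = geometric a b^-1).
  by apply: cvg_geometric; rewrite ger0_norm ?invr_ge0 ?ltW// invf_lt1.
by apply/funext => k; rewrite /geometric/= exprVn.
Qed.

Section ItoExists.
Context {R : realType} {d : measure_display} {Omega : measurableType d}.
Variables (P : probability Omega R) (T : R) (F : R -> set (set Omega)).
Variable W : R -> Omega -> R.
Hypotheses (F_filtration : filtration F T) (F_usual : usual_conditions P F T)
  (W_brownian : brownian_motion P F T W).
Hypothesis T0 : 0 <= T.
Variable H : R -> Omega -> R.
Hypotheses (cH : continuous_process T H) (aH : adapted F T H).
Notation mu := (@lebesgue_measure R).
Notation Hc := (clamped T H).

Lemma sp_integral_continuous (G : simple_process F T) w :
  continuous (fun t => sp_integral G W (clamp T t) w).
Proof.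
have cW : continuous ((clamped T W)^~ w) :=
  clamped_continuous T0 (brownian_continuous W_brownian) (w := w).
have cmin a : 0 <= a <= T -> continuous (fun t => W (Num.min a (clamp T t)) w).
  move=> /andP[a0 aT].
  have -> : (fun t => W (Num.min a (clamp T t)) w) = (fun t =>
    clamped T W (Num.min a (clamp T t)) w).
    apply/funext => t; rewrite /clamped [clamp T (Num.min _ _)]clamp_id//.
    by have /andP[h1 h2] := clamp_itv T0 t; rewrite le_min a0 h1 ge_min aT.
  move=> t; apply: (@continuous_comp _ _ _ (fun t =>
    Num.min a (clamp T t)) ((clamped T W)^~ w)); last exact: cW.
  by apply: (@continuous_min R R (cst a) (clamp T) t); [exact: cvg_cst|exact: clamp_continuous].
rewrite /sp_integral => t; apply: cvg_big => [|i _]; first exact: add_continuous.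
apply: cvgM; first exact: cvg_cst.
by apply: cvgB; apply: cmin; apply: sp_time_itv => //; exact: ltnW.
Qed.

Lemma sp_integral_start (G : simple_process F T) w : sp_integral G W 0 w = 0.
Proof.
rewrite /sp_integral big1// => i _.
have /andP[h1 _] := @sp_time_itv _ _ _ _ _ G i (ltnW (ltn_ord i)).
have /andP[h2 _] := @sp_time_itv _ _ _ _ _ G i.+1 (ltn_ord i).
by rewrite (min_idPr h1) (min_idPr h2) subrr mulr0.
Qed.

(** The rates are such that [8^-k / (2^-k)^2], which bounds the probability that two
    consecutive integrals differ by [2^-k], is summable. *)
Lemma fast_approximation : exists G : nat -> simple_process F T, forall k,
  (P [set w | (((8 ^+ k)^-1)%:E <= sqdist Hc (G k) w)%E] < ((2 ^+ k)^-1)%:E)%E.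
Proof.
have Gcvg : cvg_in_probability0 P (fun n => sqdist Hc (riemann_process F_filtration T0 aH n)).
  apply: ae_cvg_in_probability0.
    move=> n; apply: (measurable_sqdist F_filtration); first exact: clamped_continuous.
    exact: (clamped_measurable F_filtration T0 aH).
  by apply/aeW => w; exact: sqdist_riemann.
have Hn k : exists n, (P [set w | (((8 ^+ k)^-1)%:E <=
    sqdist Hc (riemann_process F_filtration T0 aH n) w)%E] < ((2 ^+ k)^-1)%:E)%E.
  have k8 : 0 < (8 ^+ k)^-1 :> R by rewrite invr_gt0 exprn_gt0.
  have k2 : 0 < (2 ^+ k)^-1 :> R by rewrite invr_gt0 exprn_gt0.
  by have [n _ /(_ n (leqnn _))] := cvg_in_probability0_lt Gcvg k8 k2; exists n.
have /choice[n nP] := Hn.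
by exists (fun k => riemann_process F_filtration T0 aH (n k)).
Qed.

Section Limit.
Variable G : nat -> simple_process F T.
Hypothesis G_fast : forall k,
  (P [set w | (((8 ^+ k)^-1)%:E <= sqdist Hc (G k) w)%E] < ((2 ^+ k)^-1)%:E)%E.

Let I k (t : R) w := sp_integral (G k) W (clamp T t) w.

Let mI k t : 0 <= t <= T -> measurable_wrt (F t) (I k t).
Proof.
by move=> tT; rewrite /I clamp_id//; exact:
  (measurable_sp_integral F_filtration W_brownian (G k) tT).
Qed.

Let mI' k t : measurable_fun setT (I k t).
Proof.
have tT := clamp_itv T0 t.
exact: (measurable_wrt_measurable (filtration_sub F_filtration tT) (measurable_sp_integral
  F_filtration W_brownian (G k) tT)).
Qed.

Let q (n : nat) : R := ratr (odflt 0 (unpickle n) : rat).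

Let A k := [set w | exists m, (2 ^+ k)^-1 <= `|I k (q m) w - I k.+1 (q m) w|].

(** Only finitely many times are within reach of [sp_integral_close]; the union over [N] is
    increasing. *)
Let AN k N := [set w | exists2 m, (m < N)%N & (2 ^+ k)^-1 <= `|I k (q m) w - I k.+1 (q m) w|].

Let mAN k N : measurable (AN k N).
Proof.
rewrite (_ : AN k N = \bigcup_(m in `I_N) [set w | (2 ^+ k)^-1 <=
  `|I k (q m) w - I k.+1 (q m) w|]).
  by apply: bigcup_measurable => m _; apply: measurable_norm_ge; exact: measurable_funB.
by apply/seteqP; split=> w [m mN h]; exists m.
Qed.

Let AE k : A k = \bigcup_N AN k N.
Proof.
apply/seteqP; split=> w.
  by case=> m h; exists m.+1 => //; exists m.
by case=> N _ [m _ h]; exists m.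
Qed.

Let mA k : measurable (A k).
Proof. by rewrite AE; apply: bigcup_measurable => N _; exact: mAN. Qed.

Let cHc : forall w, continuous (Hc^~ w). Proof. exact: clamped_continuous. Qed.
Let mHc : forall s, measurable_fun setT (Hc s). Proof. exact:
  (clamped_measurable F_filtration T0 aH). Qed.

Let PAN k N : (P (AN k N) <= (66 / 2 ^+ k)%:E)%E.
Proof.
have k8 : 0 < (8 ^+ k)^-1 :> R by rewrite invr_gt0 exprn_gt0.
have k2 : 0 < (2 ^+ k)^-1 :> R by rewrite invr_gt0 exprn_gt0.
have := sp_integral_close F_filtration W_brownian T0 cHc mHc (G k) (G k.+1)
  (s := [seq clamp T (q m) | m <- iota 0 N]) k2 k8.
have -> : [set w | exists2 t, t \in [seq clamp T (q m) | m <- iota 0 N] &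
    (2 ^+ k)^-1 <= `|sp_integral (G k) W t w - sp_integral (G k.+1) W t w|] = AN k N.
  apply/seteqP; split=> w /=.
    by case=> t /mapP[m]; rewrite mem_iota add0n => /= mN -> h; exists m.
  by case=> m mN h; exists (clamp T (q m)) => //; apply: map_f; rewrite mem_iota.
move=> /(_ _)/le_trans; apply.
  by move=> t /mapP[m _ ->]; exact: clamp_itv.
(* [8 = 2^3] leaves one factor [2^-k] in the last term *)
have -> : 66 / 2 ^+ k = (2 ^+ k)^-1 + (2 ^+ k)^-1 + 64 * (8 ^+ k)^-1 / (2 ^+ k)^-1 ^+ 2 :> R.
  have -> : 8 ^+ k = 2 ^+ k * 2 ^+ k * 2 ^+ k :> R.
    by rewrite -!exprMn; congr (_ ^+ _); ring.
  by field; rewrite expf_neq0.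
rewrite !EFinD; apply: leeD2r; apply: leeD; first exact/ltW/G_fast.
apply: (@le_trans _ _ (P [set w | (((8 ^+ k.+1)^-1)%:E <= sqdist Hc (G k.+1) w)%E])).
  apply: le_measure; rewrite ?inE; try exact: measurable_sqdist_ge.
  move=> w /=; apply: le_trans; rewrite lee_fin lef_pV2 ?posrE ?exprn_gt0//.
  by rewrite exprS ler_peMl ?exprn_ge0// ler1n.
apply: le_trans (ltW (G_fast k.+1)) _; rewrite lee_fin lef_pV2 ?posrE ?exprn_gt0//.
by rewrite exprS ler_peMl ?exprn_ge0// ler1n.
Qed.

Let PA k : (P (A k) <= (66 / 2 ^+ k)%:E)%E.
Proof.
rewrite AE; apply: (cvge_le _ (nondecreasing_cvg_mu (mu := P) (mAN k) _ _)).
- by apply: nearW => N; exact: PAN.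
- by rewrite -AE.
- move=> N M NM; apply/subsetPset => w [m mN h]; exists m => //; exact: leq_trans NM.
Qed.

(** By the Borel-Cantelli lemma this set, off which consecutive integrals are eventually
    close uniformly in time, is negligible. *)
Let bad := lim_sup_set A.

Let mbad : measurable bad.
Proof.
by apply: bigcap_measurable; [exists 0%N|move=> k _; apply: bigcup_measurable => j _;
  exact: mA].
Qed.

Let Pbad : P bad = 0%E.
Proof.
apply: lim_sup_set_cvg0 => //.
apply: (@le_lt_trans _ _ (\sum_(0 <= k <oo) (132 / (2 ^ k.+1)%:R)%:E)%E).
  apply: lee_nneseries => // k _; apply: (le_trans (PA k)).
  by rewrite lee_fin natrX exprS invfM mulrA; apply: ler_wpM2r;
    rewrite ?invr_ge0 ?exprn_ge0//; lra.
by apply: le_lt_trans (epsilon_trick0 xpredT _) _; rewrite ?ltry.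
Qed.

Let good_bound w : ~ bad w -> exists k0, forall k, (k0 <= k)%N -> forall t,
  `|I k t w - I k.+1 t w| <= (2 ^+ k)^-1.
Proof.
move=> nb; have /existsNP[k0 nk0] : ~ forall n, (\bigcup_(j in [set j | (n <= j)%N]) A j) w.
  by move=> h; apply: nb => n _; exact: h.
exists k0 => k kk0.
have cD : continuous (fun t => `|I k t w - I k.+1 t w|).
  by move=> t; apply: cvg_norm; apply: cvgB; exact: sp_integral_continuous.
apply: (continuous_le_rat cD) => x; rewrite leNgt; apply/negP => h.
apply: nk0; exists k => //; exists (pickle x).
by rewrite /q pickleK/= ltW.
Qed.

Let good_cauchy w : ~ bad w -> exists k0, forall t, exists l,
  I k t w @[k --> \oo] --> l /\ forall k, (k0 <= k)%N -> `|I k t w - l| <= 2 / 2 ^+ k.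
Proof.
move=> /good_bound[k0 Hk]; exists k0 => t.
have tele n m : `|I (k0 + n)%N t w - I (k0 + n + m)%N t w| <=
    2 / 2 ^+ (k0 + n) - 2 / 2 ^+ (k0 + n + m).
  elim: m => [|m IH]; first by rewrite addn0 !subrr normr0.
  have := Hk (k0 + n + m)%N (leq_trans (leq_addr _ _) (leq_addr _ _)) t.
  rewrite addnS => h.
  apply: (le_trans (ler_distD (I (k0 + n + m)%N t w) _ _)).
  apply: (le_trans (lerD IH h)).
  rewrite exprS invfM mulrA divff// mul1r; set z := (2 ^+ _)^-1; set y := (2 ^+ _)^-1; lra.
have := @cvg_cauchy_rate R (fun n => I (k0 + n)%N t w) (fun n => 2 / 2 ^+ (k0 + n)).
case.
- move=> n m nm; rewrite -(subnKC nm) addnA; apply: (le_trans (tele _ _)).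
  by rewrite gerBl divr_ge0// exprn_ge0.
- rewrite (_ : (fun n => _) = (fun n => 2 / 2 ^+ (n + k0))); last first.
    by apply/funext => n; rewrite addnC.
  rewrite (cvg_shiftn k0 (fun n => 2 / 2 ^+ n : R)).
  by apply: cvg_inv_expr; rewrite ltr1n.
move=> l [Il lb]; exists l; split.
  rewrite -(cvg_shiftn k0); rewrite (_ : (fun n => _) = (fun n => I (k0 + n)%N t w))//.
  by apply/funext => n; rewrite addnC.
by move=> k kk0; have := lb (k - k0)%N; rewrite subnKC.
Qed.

Let J (t : R) (w : Omega) : R := if pselect (bad w) then 0 else lim (I k t w @[k --> \oo]).

Let J_good w : ~ bad w -> exists k0, forall t,
  I k t w @[k --> \oo] --> J t w /\ forall k, (k0 <= k)%N -> `|I k t w - J t w| <= 2 / 2 ^+ k.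
Proof.
move=> nb; have [k0 Hk0] := good_cauchy nb; exists k0 => t; have [l [Il lb]] := Hk0 t.
have -> : J t w = l.
  by rewrite /J; case: pselect => //= _; apply/cvg_lim.
by split.
Qed.

Let J_bad w : bad w -> forall t, J t w = 0.
Proof. by move=> b t; rewrite /J; case: pselect. Qed.

(** Off [bad] the rate of convergence does not depend on the time, so that [J] is a uniform
    limit of continuous paths. *)
Let J_continuous w : continuous (J^~ w).
Proof.
have [b|nb] := pselect (bad w).
  rewrite (_ : J^~ w = cst 0); first exact: cst_continuous.
  by apply/funext => t; rewrite J_bad.
have [k0 Hk] := J_good nb.
move=> t; apply/cvgrPdist_le => e e0.
have lim0 : 2 / 2 ^+ k @[k --> \oo] --> (0 : R).
  by apply: cvg_inv_expr; rewrite ltr1n.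
have e30 : 0 < e / 3 by rewrite divr_gt0.
have /cvgrPdist_le/(_ _ e30)[N _ HN] := lim0.
pose k := maxn N k0.
have ke : 2 / 2 ^+ k <= e / 3.
  by have := HN k (leq_maxl _ _); rewrite /= sub0r normrN; apply: le_trans; exact: ler_norm.
have close s : `|I k s w - J s w| <= e / 3.
  by apply: le_trans ke; have [_] := Hk s; apply; exact: leq_maxr.
have := @sp_integral_continuous (G k) w t; move=> /cvgrPdist_le/(_ _ e30).
apply: filterS => s; rewrite -!/(I k _ w) => h.
have -> : J t w - J s w = (I k t w - I k s w) - (I k t w - J t w) + (I k s w - J s w) by ring.
have : e = e / 3 + e / 3 + e / 3 by field.
have := ler_normD ((I k t w - I k s w) - (I k t w - J t w)) (I k s w - J s w).
have := ler_normB (I k t w - I k s w) (I k t w - J t w).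
have := close s; have := close t; lra.
Qed.

(** [J] is a limit of adapted processes multiplied by the indicator of the complement of
    [bad], which belongs to the initial sigma-algebra by completeness. *)
Let J_adapted : adapted F T J.
Proof.
move=> t tT; have sFt := filtration_sigma F_filtration tT; have /andP[t0 tT'] := tT.
have Fbad : F t (~` bad).
  have F0 : F 0 bad by apply: (usual_complete F_usual); exists bad; split.
  have Ftbad := filtration_mono F_filtration (lexx 0) t0 tT' F0.
  by have [_ + _] := sFt => /(_ _ Ftbad); rewrite setTD.
apply/(measurable_wrtP _ sFt).
apply: (@measurable_fun_cvg _ (g_sigma_algebraType (F t)) R setT (fun k w =>
  I k t w * \1_(~` bad) w)).
  move=> k; apply: measurable_funM; first by apply/(measurable_wrtP _ sFt); exact: mI.
  by apply: measurable_indic; rewrite /measurable/= (sigma_algebra_id sFt).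
move=> w _; have [b|nb] := pselect (bad w).
  have nbb : ~ (~` bad) w by move=> h; exact: h.
  rewrite (J_bad b t) indicE memNset//=.
  by under eq_cvg do rewrite mulr0; exact: cvg_cst.
rewrite indicE mem_set//=; under eq_cvg do rewrite mulr1.
by have [k0 /(_ t)[]] := J_good nb.
Qed.

Lemma ito_limit : exists2 J', is_ito_integral P F T W H J' & forall w, J' 0 w = 0.
Proof.
exists J; last first.
  move=> w; have [b|nb] := pselect (bad w); first by rewrite J_bad.
  have [k0 /(_ 0)[+ _]] := J_good nb.
  have -> : (fun k => I k 0 w) = cst 0.
    by apply/funext => k; rewrite /I clamp_id ?lexx// sp_integral_start.
  by move=> h; apply: cvg_unique h (cvg_cst 0).
split=> //.
  move=> w; apply: within_continuous_clamp => t.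
  apply: (@continuous_comp _ _ _ (clamp T) (J^~ w)); last exact: J_continuous.
  exact: clamp_continuous.
exists G; split.
  have -> : (fun n w => (\int[lebesgue_measure]_(s in `[0%R, T]) ((sp_val (G n) s w - H s w)
    ^+ 2)%:E)%E)
      = (fun n => sqdist Hc (G n)).
    by apply/funext => n; apply/funext => w; rewrite sqdist_clamped.
  move=> e e0.
  have lim8 : (8 ^+ k)^-1 @[k --> \oo] --> (0 : R).
    by under eq_cvg do rewrite -[_^-1]mul1r; apply: cvg_inv_expr; rewrite ltr1n.
  have lim2 : ((2 ^+ k)^-1)%:E @[k --> \oo] --> (0 : \bar R).
    apply: cvg_EFin; first exact: nearW.
    by under eq_cvg do rewrite /= -[_^-1]mul1r; apply: cvg_inv_expr; rewrite ltr1n.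
  apply: (@squeeze_cvge _ _ _ _ (cst 0%E) _ (fun k => ((2 ^+ k)^-1)%:E)) => //;
    last exact: cvg_cst.
  have /cvgrPdist_le/(_ _ e0) := lim8; apply: filterS => k.
  rewrite /= sub0r normrN ger0_norm ?invr_ge0 ?exprn_ge0// => ke.
  rewrite measure_ge0/=; apply: le_trans (ltW (G_fast k)).
  apply: le_measure; rewrite ?inE; try exact: measurable_sqdist_ge.
  by move=> w /=; apply: le_trans; rewrite lee_fin.
move=> t tT; apply: ae_cvg_in_probability0.
  move=> n; apply/measurable_EFinP; apply: measurableT_comp => //.
  apply: measurable_funB; first exact: (adapted_measurable F_filtration J_adapted tT).
  by have := mI' n t; rewrite /I clamp_id.
exists bad; split => // w /= nw; apply: contrapT => nb; apply: nw.
have [k0 /(_ t)[It _]] := J_good nb.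
apply: cvg_EFin; first exact: nearW.
rewrite [X in _ --> X](_ : _ = `|J t w - J t w|); last by rewrite subrr normr0.
apply: cvg_norm; apply: cvgB; first exact: cvg_cst.
by move: It; rewrite /I clamp_id.
Qed.

End Limit.

Lemma ito_exists : exists2 J, is_ito_integral P F T W H J & forall w, J 0 w = 0.
Proof. by have [G GP] := fast_approximation; exact: ito_limit GP. Qed.

End ItoExists.

(** * Nonincreasing drifts *)

(** The hypothesis is a Lipschitz bound near every pair of points; it is used on the
    diagonal. *)
Lemma locally_lipschitz_continuous {R : realType} (g : R -> R) :
  [locally [lipschitz g x | x in setT]] -> continuous g.
Proof.
move=> lg x; have := lg (x, x) (conj Logic.I Logic.I).
move=> [M0 [_ HM]].
have := HM (`|M0| + 1) (le_lt_trans (ler_norm M0) _); rewrite ltrDl => /(_ ltr01).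
set M := `|M0| + 1; have M1 : 0 < M by rewrite /M ltr_wpDl.
rewrite /= => -[[U V] /= [Ux Vx]] UV.
apply/cvgrPdist_lt => e e0.
near=> y.
have : `|g x - g y| <= M * `|x - y|.
  apply: (UV (x, y)) => //; split => /=; [exact: nbhs_singleton|near: y; exact: Vx].
move=> /le_lt_trans; apply.
rewrite mulrC -ltr_pdivlMr//; near: y; apply/nbhs_ballP; exists (e / M) => //=.
by rewrite divr_gt0.
Unshelve. all: by end_near. Qed.

Section Drift.
Context {R : realType} {d : measure_display} {Omega : measurableType d}.
Variables (T : R) (F : R -> set (set Omega)).
Hypotheses (F_filtration : filtration F T) (T0 : 0 <= T).
Variables (a b m : R -> Omega -> R) (g : R -> R).
Hypotheses (a_adapted : adapted F T a) (a_continuous : continuous_process T a).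
Hypotheses (b_adapted : adapted F T b) (b_continuous : continuous_process T b).
Hypotheses (m_adapted : adapted F T m) (m_continuous : continuous_process T m).
Hypothesis a_ge0 : forall t w, 0 <= t <= T -> 0 <= a t w.
Hypothesis m_ge0 : forall t w, 0 <= t <= T -> 0 <= m t w.
Hypotheses (g_continuous : continuous g) (g_nondecreasing : forall x y, x <= y -> g x <= g y).

Definition drift (t : R) (w : Omega) (x : R) : R := b t w - a t w * g (m t w * x).

Definition cdrift (t : R) (w : Omega) (x : R) : R := drift (clamp T t) w x.

Lemma cdrift_noninc t w x y : x <= y -> cdrift t w y <= cdrift t w x.
Proof.
move=> xy; have tT := clamp_itv T0 t.
rewrite /cdrift /drift lerD2l lerN2 ler_wpM2l ?a_ge0// g_nondecreasing//.
by rewrite ler_wpM2l ?m_ge0.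
Qed.

Lemma cdrift_continuous w (y : R -> R) : continuous y ->
  continuous (fun p : R * R => cdrift p.1 w (y p.1 + p.2)).
Proof.
have cfst (X : R -> Omega -> R) (p : R * R) : continuous_process T X ->
    clamped T X q.1 w @[q --> p] --> clamped T X p.1 w.
  move=> cX; apply: (@continuous_comp _ _ _ fst ((clamped T X)^~ w)); first exact: cvg_fst.
  exact: (clamped_continuous T0 cX).
move=> cy p; apply: cvgB; first exact: cfst.
apply: cvgM; first exact: cfst.
apply: (@continuous_comp _ _ _ (fun p : R * R => m (clamp T p.1) w * (y p.1 + p.2)) g);
  last exact: g_continuous.
apply: cvgM; first exact: cfst.
apply: cvgD; last exact: cvg_snd.
by apply: (@continuous_comp _ _ _ fst y); [exact: cvg_fst|exact: cy].
Qed.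

Lemma cdrift_path_continuous w (x : R -> R) : continuous x ->
  continuous (fun s => cdrift s w (x s)).
Proof.
move=> cx.
have -> : (fun s => cdrift s w (x s)) = (fun s => cdrift s w (cst 0 s + x s)).
  by apply/funext => s; rewrite /= add0r.
apply: (@continuous_along R (fun s v => cdrift s w (cst 0 s + v))) => //.
exact: (@cdrift_continuous w (cst 0) (@cst_continuous _ _ 0)).
Qed.

Lemma drift_superposable (y : R -> Omega -> R) : adapted F T y ->
  superposable F T (fun t w v => cdrift t w (y t w + v)).
Proof.
move=> ay t Z tT mZ; have sFt := filtration_sigma F_filtration tT.
rewrite /cdrift clamp_id// /drift.
have tom X : measurable_wrt (F t) X -> measurable_fun setT (X : g_sigma_algebraType (F t) -> R).
  by move=> /(measurable_wrtP _ sFt).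
apply/(measurable_wrtP _ sFt); apply: measurable_funB; first exact: (tom _ (b_adapted tT)).
apply: measurable_funM; first exact: (tom _ (a_adapted tT)).
apply: (measurableT_comp (continuous_measurable_fun g_continuous)).
apply: measurable_funM; first exact: (tom _ (m_adapted tT)).
by apply: measurable_funD; [exact: (tom _ (ay _ tT))|exact: tom].
Qed.

Lemma primitive_drift (x : R -> R) (w : Omega) t : 0 <= t <= T ->
  \int[lebesgue_measure]_(s in `[0, t]) drift s w (x s) =
  primitive (fun s => cdrift s w (x (clamp T s))) t.
Proof.
move=> /andP[t0 tT]; apply: eq_primitive => s /andP[s0 st].
by rewrite /cdrift clamp_id// s0 (le_trans st).
Qed.

Lemma drift_integrable (x : R -> R) (w : Omega) : {within `[0, T], continuous x} ->
  lebesgue_measure.-integrable `[0, T] (fun s => (drift s w (x s))%:E).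
Proof.
move=> cx; have cX := clamp_continuous_within T0 cx.
have := continuous_integrable 0 T (cdrift_path_continuous (w := w) cX).
apply: eq_integrable => // s; rewrite inE/= in_itv/= => sT.
by rewrite /cdrift clamp_id.
Qed.

(** Let [D] be the difference of the two solutions.  It is a primitive, since [j] cancels,
    and [D D' <= 0] because the drift is nonincreasing. *)
Lemma drift_unique (x y j : R -> R) (x0 : R) (w : Omega) :
  {within `[0, T], continuous x} -> {within `[0, T], continuous y} ->
  (forall t, 0 <= t <= T -> x t = x0 +
    \int[lebesgue_measure]_(s in `[0, t]) drift s w (x s) + j t) ->
  (forall t, 0 <= t <= T -> y t = x0 +
    \int[lebesgue_measure]_(s in `[0, t]) drift s w (y s) + j t) ->
  forall t, 0 <= t <= T -> x t = y t.
Proof.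
move=> cx cy xE yE.
have cX := clamp_continuous_within T0 cx; have cY := clamp_continuous_within T0 cy.
have cbX := cdrift_path_continuous (w := w) cX; have cbY := cdrift_path_continuous (w := w) cY.
pose phi s := cdrift s w (x (clamp T s)) - cdrift s w (y (clamp T s)).
have cphi : continuous phi by move=> s; apply: cvgB; [exact: cbX|exact: cbY].
have DE s : 0 <= s <= T -> primitive phi s = x s - y s.
  move=> sT; rewrite xE// yE// !primitive_drift// /primitive RintegralB//;
    try exact: continuous_integrable.
  by rewrite -/(primitive _ _) -/(primitive _ _); ring.
move=> t tT; apply/eqP; rewrite -subr_eq0 -sqrf_eq0 -DE// eq_le sqr_ge0 andbT.
have [t0 _] := andP tT.
have := @primitive_energy _ phi (cst 0) T t cphi (@cst_continuous _ _ 0) _ _ tT.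
rewrite primitive_cst// mul0r mulr0; apply=> // s sT.
rewrite DE// addr0; apply: (@le_trans _ _ 0); last exact: sqr_ge0.
rewrite mulr_ge0_le0// /phi clamp_id//.
have [h|/ltW h] := leP (x s) (y s).
  by rewrite mulr_le0_ge0 ?subr_le0// subr_ge0 cdrift_noninc.
by rewrite mulr_ge0_le0 ?subr_ge0// subr_le0 cdrift_noninc.
Qed.

End Drift.

(** * The stochastic differential equation *)

Section MonotoneSDE.
Context {R : realType} {d : measure_display} {Omega : measurableType d}.
Variables (P : probability Omega R) (T : R) (F : R -> set (set Omega)).
Variable W : R -> Omega -> R.
Hypotheses (F_filtration : filtration F T) (F_usual : usual_conditions P F T)
  (W_brownian : brownian_motion P F T W) (T0 : 0 <= T).
Variables (a b m sigma : R -> Omega -> R) (g : R -> R).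
Hypotheses (a_adapted : adapted F T a) (a_continuous : continuous_process T a).
Hypotheses (b_adapted : adapted F T b) (b_continuous : continuous_process T b).
Hypotheses (m_adapted : adapted F T m) (m_continuous : continuous_process T m).
Hypotheses (sigma_adapted : adapted F T sigma) (sigma_continuous : continuous_process T sigma).
Hypothesis a_ge0 : forall t w, 0 <= t <= T -> 0 <= a t w.
Hypothesis m_ge0 : forall t w, 0 <= t <= T -> 0 <= m t w.
Hypotheses (g_continuous : continuous g) (g_nondecreasing : forall x y, x <= y -> g x <= g y).

(** [X = x0 + J + V], where [J] is the stochastic integral of [sigma] and [V] solves the
    random differential equation obtained by subtracting [x0 + J]. *)
Lemma monotone_sde (x0 : R) :
  exists_unique_strong_solution P F T W (drift a b m g) (fun t w _ => sigma t w) x0.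
Proof.
have [J itoJ J0] := ito_exists F_filtration F_usual W_brownian T0 sigma_continuous
  sigma_adapted.
have [cJ aJ _] := itoJ.
pose y t w := x0 + J t w.
have ay : adapted F T y.
  move=> t tT; have sFt := filtration_sigma F_filtration tT.
  by apply/(measurable_wrtP _ sFt); apply: measurable_funD => //;
    apply/(measurable_wrtP _ sFt); exact: aJ.
have cJc w : continuous ((clamped T J)^~ w) by exact: clamped_continuous.
have cyc w : continuous (fun t => clamped T y t w).
  by move=> t; apply: cvgD; [exact: cvg_cst|exact: cJc].
have ayc : adapted F T (clamped T y).
  by move=> t tT; rewrite /clamped clamp_id//; exact: ay.
have [V [cV aV VE]] := @random_monotone_ode R d Omega F T F_filtration T0
  (fun t w v => cdrift T a b m g t w (clamped T y t w + v))
  (fun w => cdrift_continuous T0 a_continuous b_continuous m_continuous g_continuous (cyc w))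
  (fun t w u v uv => cdrift_noninc T0 b a_ge0 m_ge0 g_nondecreasing t w (lerD (lexx _) uv))
  (drift_superposable F_filtration a_adapted b_adapted m_adapted g_continuous ayc).
pose X t w := y t w + V t w.
have cX : continuous_process T X.
  move=> w; apply: within_continuous_clamp => t; apply: cvgD; first exact: cyc.
  by apply: (@continuous_comp _ _ _ (clamp T) (V^~ w)); [exact: clamp_continuous|exact: cV].
have XE w t : 0 <= t <= T ->
    X t w = x0 + \int[lebesgue_measure]_(s in `[0, t]) drift a b m g s w (X s w) + J t w.
  move=> tT; have /andP[t0 tT'] := tT.
  rewrite (@primitive_drift _ _ _ T a b m g (X^~ w))// /X VE// /y.
  rewrite -addrA [J t w + _]addrC addrA; congr (_ + _ + _).
  apply: eq_primitive => s /andP[s0 st]; congr (cdrift _ _ _ _ _ _ _ _).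
  by rewrite /clamped clamp_id// s0 (le_trans st).
exists X; first split => //.
- move=> t tT; have sFt := filtration_sigma F_filtration tT.
  by apply/(measurable_wrtP _ sFt); apply: measurable_funD;
    apply/(measurable_wrtP _ sFt); [exact: ay|exact: aV].
- apply/aeW => w; split; first exact: drift_integrable.
  have cs : continuous (fun t => clamped T sigma t w ^+ 2).
    by move=> t; apply: cvgM; exact: (clamped_continuous T0 sigma_continuous).
  have := continuous_integrable 0 T cs.
  by apply: eq_integrable => // s; rewrite inE/= in_itv/= => sT; rewrite /clamped clamp_id.
- apply/aeW => w; rewrite XE ?lexx//.
  by rewrite set_itv1 Rintegral_set1 J0 !addr0.
- by exists J => //; apply/aeW => w t; exact: XE.
move=> Y [cY aY _ _ [J' itoJ' YE]].
have := ito_unique F_filtration W_brownian T0 sigma_continuous sigma_adapted itoJ itoJ'.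
move: YE; apply: filterS2 => w YE JJ' t tT.
apply: (drift_unique T0 a_continuous b_continuous m_continuous a_ge0 m_ge0
  g_continuous g_nondecreasing (w := w) (x := X^~ w) (y := Y^~ w) (j := J^~ w) (x0 :=
    x0)) => // s sT; first exact: XE.
by rewrite JJ'//; exact: YE.
Qed.

End MonotoneSDE.

Section ProcessAlgebra.
Context {R : realType} {d : measure_display} {Omega : measurableType d}.
Variables (T : R) (F : R -> set (set Omega)).
Hypotheses (F_filtration : filtration F T) (T0 : 0 <= T).
Implicit Types X Y : R -> Omega -> R.

Lemma adapted_mul X Y : adapted F T X -> adapted F T Y ->
  adapted F T (fun t w => X t w * Y t w).
Proof.
move=> aX aY t tT; have sFt := filtration_sigma F_filtration tT.
by apply/(measurable_wrtP _ sFt); apply: measurable_funM; apply/(measurable_wrtP _ sFt);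
  [exact: aX|exact: aY].
Qed.

Lemma adapted_comp (h : R -> R) X : continuous h -> adapted F T X ->
  adapted F T (fun t w => h (X t w)).
Proof.
move=> ch aX t tT; have sFt := filtration_sigma F_filtration tT.
apply/(measurable_wrtP _ sFt); apply: (measurableT_comp (continuous_measurable_fun ch)).
by apply/(measurable_wrtP _ sFt); exact: aX.
Qed.

Lemma continuous_process_mul X Y : continuous_process T X -> continuous_process T Y ->
  continuous_process T (fun t w => X t w * Y t w).
Proof.
by move=> cX cY w; apply: within_continuous_clamp => t; apply: cvgM;
  [exact: (clamped_continuous T0 cX)|exact: (clamped_continuous T0 cY)].
Qed.

Lemma continuous_process_comp (h : R -> R) X : continuous h -> continuous_process T X ->
  continuous_process T (fun t w => h (X t w)).
Proof.
move=> ch cX w; apply: within_continuous_clamp => t.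
apply: (@continuous_comp _ _ _ ((clamped T X)^~ w) h); last exact: ch.
exact: (clamped_continuous T0 cX).
Qed.

End ProcessAlgebra.

Unset Implicit Arguments.
Set Strict Implicit.
Set Printing Implicit Defensive.

Theorem proposition1p1
  (R : realType) (d : measure_display) (Omega : measurableType d)
  (P : probability Omega R) (T : R) (F : R -> set (set Omega))
  (W b c L M : R -> Omega -> R) (g : R -> R)
  (T_gt0 : 0 < T)
  (F_filtration : filtration F T)
  (F_usual : usual_conditions P F T)
  (W_brownian : brownian_motion P F T W)
  (b_adapted : adapted F T b) (b_continuous : continuous_process T b)
  (c_adapted : adapted F T c) (c_continuous : continuous_process T c)
  (L_adapted : adapted F T L) (L_continuous : continuous_process T L)
  (M_adapted : adapted F T M) (M_continuous : continuous_process T M)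
  (c_gt0 : forall t w, 0 <= t <= T -> 0 < c t w)
  (L_gt0 : forall t w, 0 <= t <= T -> 0 < L t w)
  (M_gt0 : forall t w, 0 <= t <= T -> 0 < M t w)
  (g_locally_lipschitz : [locally [lipschitz g x | x in setT]])
  (g_odd : forall x, g (- x) = - g x)
  (g_nondecreasing : forall x y, x <= y -> g x <= g y)
  (g_ge0 : forall x, 0 <= x -> 0 <= g x)
  (g_growth : exists2 q : R, 1 <= q &
     (0 < limf_einf (fun x : R => (g x / x `^ q)%:E) (+oo%R : set_system R))%E) :
  forall (eps : R) (x0 : R), 0 < eps ->
    exists_unique_strong_solution P F T W
      (fun t w x => b t w - c t w * L t w / eps * g (M t w * x / eps))
      (fun t w _ => Num.sqrt (c t w))
      x0.
Proof.
move=> eps x0 eps0; have T0 : 0 <= T by exact: ltW.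
have cdiv : continuous (fun x : R => x / eps).
  by move=> x; apply: cvgM; [exact: cvg_id|exact: cvg_cst].
pose a t w := c t w * L t w / eps; pose m t w := M t w / eps.
have -> : (fun t w x => b t w - c t w * L t w / eps * g (M t w * x / eps)) = drift a b m g.
  apply/funext => t; apply/funext => w; apply/funext => x.
  by rewrite /drift /a /m (mulrAC (M t w)).
apply: monotone_sde => //.
- by apply: (adapted_comp F_filtration cdiv); exact: adapted_mul.
- by apply: (continuous_process_comp T0 cdiv); exact: continuous_process_mul.
- exact: (adapted_comp F_filtration cdiv).
- exact: (continuous_process_comp T0 cdiv).
- exact: (adapted_comp F_filtration (@sqrt_continuous R)).
- exact: (continuous_process_comp T0 (@sqrt_continuous R)).
- by move=> t w tT; rewrite /a ltW// divr_gt0// mulr_gt0// ?c_gt0 ?L_gt0.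
- by move=> t w tT; rewrite /m ltW// divr_gt0// M_gt0.
- exact: locally_lipschitz_continuous.
Qed.
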